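(* Let $f\colon\mathrm{SO}(3)\to\mathbb C$ be given in Euler angles $\alpha,\gamma\in\mathbb T$, $\beta\in[0,\pi]$ by $$f(R(\alpha,\beta,\gamma))=\begin{cases}\dfrac1{\sqrt{\sin\beta}}, & \beta\notin\{0,\pi\},\\ 0,&\text{otherwise.}\end{cases}$$ Then $f\in H^s(\mathrm{SO}(3))$ for every $0\le s<\tfrac12$, and $f\circ\phi\notin L^2(\mathbb T^3)$.
   Context: $\mathbb T=\mathbb R/2\pi\mathbb Z$. $R_y(\cdot),R_z(\cdot)$ denote the rotations about the $y$- and $z$-axis, and $R(\alpha,\beta,\gamma)=R_z(\alpha)R_y(\beta)R_z(\gamma)$; every element of $\mathrm{SO}(3)$ has this form with $\alpha,\gamma\in\mathbb T$, $\beta\in[0,\pi]$. The Euler angle map is $\phi\colon\mathbb T^3\to\mathrm{SO}(3)$, $\phi(\alpha,\beta,\gamma)=R(\alpha,\beta,\gamma)$. $L^2(\mathrm{SO}(3))$ is taken with respect to the Haar probability measure, $d\mu(R(\alpha,\beta,\gamma))=\frac1{8\pi^2}\sin\beta\,d\alpha\,d\beta\,d\gamma$; $L^2(\mathbb T^3)$ is taken with respect to Lebesgue measure. Wigner-d functions: for $n\in\mathbb N_0$, $k,l\in\mathbb Z$, $|k|,|l|\le n$, and $x\in[-1,1]$, $$d_n^{k,l}(x)=(-1)^{\nu}\binom{2n-s}{s+a}^{1/2}\binom{s+b}{b}^{-1/2}\Big(\frac{1-x}2\Big)^{a/2}\Big(\frac{1+x}2\Big)^{b/2}P_s^{a,b}(x),$$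 where $a=|k-l|$, $b=|k+l|$, $s=n-\max\{|k|,|l|\}$, $\nu=k+l$ if $k>l$ and $\nu=0$ otherwise, and $P_s^{a,b}$ is the Jacobi polynomial of degree $s$ with parameters $a,b$. Wigner-D functions: $D_n^{k,l}(R(\alpha,\beta,\gamma))=\sqrt{2n+1}\,e^{-\mathrm ik\alpha}\,d_n^{k,l}(\cos\beta)\,e^{-\mathrm il\gamma}$ for $\beta\in[0,\pi]$; they form an orthonormal basis of $L^2(\mathrm{SO}(3))$. For $s\ge0$, $H^s(\mathrm{SO}(3))$ is the set of $f\in L^2(\mathrm{SO}(3))$ whose harmonic coefficients $\hat f_n^{k,l}=\langle f,D_n^{k,l}\rangle_{L^2(\mathrm{SO}(3))}$ satisfy $\sum_{n=0}^\infty\sum_{k,l=-n}^n(1+n(n+1))^s|\hat f_n^{k,l}|^2<\infty$. *)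

(* Defs.v *)
From HB Require Import structures.
From mathcomp Require Import all_boot all_order all_algebra.
From mathcomp Require Import all_classical all_reals all_analysis.
From mathcomp Require Import measurable_realfun ring.
From mathcomp Require Import complex.

Set Implicit Arguments.
Unset Strict Implicit.
Unset Printing Implicit Defensive.

Import Order.TTheory GRing.Theory Num.Theory.
Import numFieldNormedType.Exports.

Local Open Scope classical_set_scope.
Local Open Scope ring_scope.
Local Open Scope complex_scope.
Local Open Scope quotient_scope.

Section Rotations.
Variable R : realType.
Implicit Types a b c : R.

Definition SO3_set : set 'M[R]_3 := [set A | A^T *m A = 1%:M /\ \det A = 1].

Definition Rz a : 'M[R]_3 := \matrix_(i, j)
  (nth [::] [:: [:: cos a; - sin a; 0]; [:: sin a; cos a; 0]; [:: 0; 0; 1]] i)`_j.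

Definition Ry b : 'M[R]_3 := \matrix_(i, j)
  (nth [::] [:: [:: cos b; 0; sin b]; [:: 0; 1; 0]; [:: - sin b; 0; cos b]] i)`_j.

Lemma SO3_set1 : SO3_set 1%:M.
Proof. by rewrite /SO3_set/= trmx1 mulmx1 det1. Qed.

Lemma SO3_setM A B : SO3_set A -> SO3_set B -> SO3_set (A *m B).
Proof.
move=> [AA dA] [BB dB]; split; last by rewrite det_mulmx dA dB mulr1.
by rewrite trmx_mul -mulmxA (mulmxA A^T) AA mul1mx BB.
Qed.

Lemma SO3_set_Rz a : SO3_set (Rz a).
Proof.
have H := sin2cos2 a; split.
  apply/matrixP=> i j; rewrite !mxE.
  rewrite !big_ord_recl big_ord0 !mxE/=.
  case: i => [[|[|[|//]]] ?]; case: j => [[|[|[|//]]] ?] /=;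
  by rewrite ?mulr1n ?mulr0n; ring: H.
rewrite (expand_det_row _ ord0) !big_ord_recl big_ord0 /cofactor.
rewrite !(expand_det_row _ ord0) !big_ord_recl !big_ord0 /cofactor.
by rewrite !det_mx11 !mxE /= ?expr0 ?expr1; ring: H.
Qed.

Lemma SO3_set_Ry b : SO3_set (Ry b).
Proof.
have H := sin2cos2 b; split.
  apply/matrixP=> i j; rewrite !mxE.
  rewrite !big_ord_recl big_ord0 !mxE/=.
  case: i => [[|[|[|//]]] ?]; case: j => [[|[|[|//]]] ?] /=;
  by rewrite ?mulr1n ?mulr0n; ring: H.
rewrite (expand_det_row _ ord0) !big_ord_recl big_ord0 /cofactor.
rewrite !(expand_det_row _ ord0) !big_ord_recl !big_ord0 /cofactor.
by rewrite !det_mx11 !mxE /= ?expr0 ?expr1; ring: H.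
Qed.

Lemma SO3_set_euler a b c : SO3_set (Rz a *m Ry b *m Rz c).
Proof.
by apply: SO3_setM (SO3_set_Rz c); apply: SO3_setM (SO3_set_Rz a) (SO3_set_Ry b).
Qed.

Definition SO3 : Type := SO3_set.

HB.instance Definition _ := Topological.on SO3.
HB.instance Definition _ :=
  isPointed.Build SO3 (exist _ 1%:M (mem_set SO3_set1) : SO3).
HB.instance Definition _ := Measurable.copy SO3 (g_sigma_algebraType (@open SO3)).

Definition euler a b c : SO3 :=
  exist _ (Rz a *m Ry b *m Rz c) (mem_set (SO3_set_euler a b c)).

End Rotations.

Section Circle.
Variable R : realType.

Definition mod2pi (x y : R) : bool := (x - y) / (pi *+ 2) \is a Num.int.

Lemma mod2pi_refl : reflexive mod2pi.
Proof. by move=> x; rewrite /mod2pi subrr mul0r rpred0. Qed.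

Lemma mod2pi_sym : symmetric mod2pi.
Proof. by move=> x y; rewrite /mod2pi -opprB mulNr rpredN. Qed.

Lemma mod2pi_trans : transitive mod2pi.
Proof.
move=> y x z; rewrite /mod2pi => xy yz.
by rewrite -(subrKA y) mulrDl rpredD.
Qed.

Canonical mod2pi_equiv := EquivRel mod2pi mod2pi_refl mod2pi_sym mod2pi_trans.

(* R / 2 pi Z with the quotient topology and its Borel sigma-algebra *)
Definition circle := {eq_quot mod2pi}.
HB.instance Definition _ := Quotient.on circle.
HB.instance Definition _ := Topological.copy circle (quotient_topology circle).
HB.instance Definition _ := isPointed.Build circle (\pi_circle 0).
HB.instance Definition _ := Measurable.copy circle (g_sigma_algebraType (@open circle)).

Lemma measurable_circle_pi : measurable_fun [set: R] (\pi_circle : R -> circle).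
Proof.
apply: (@measurability _ _ _ _ _ _ (@open circle)) => // _ [U oU <-].
rewrite setTI; apply: open_measurable.
by move/continuousP : (@pi_continuous R circle); exact.
Qed.

Lemma measurable_period : measurable (`[0, pi *+ 2[ : set R).
Proof. exact: measurable_itv. Qed.

(* Lebesgue measure on R / 2 pi Z, of total mass 2 pi *)
Definition circle_measure : set circle -> \bar R :=
  pushforward (mrestr lebesgue_measure measurable_period) (\pi_circle : R -> circle).

Let circle_measure0 : circle_measure set0 = 0%E.
Proof. by rewrite /circle_measure /pushforward preimage_set0 measure0. Qed.

Let circle_measure_ge0 A : (0 <= circle_measure A)%E.
Proof. by rewrite /circle_measure /pushforward; exact: measure_ge0. Qed.

Let circle_measure_sigma_additive : semi_sigma_additive circle_measure.
Proof.
move=> F mF tF mUF; rewrite /circle_measure /pushforward preimage_bigcup.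
apply: measure_semi_sigma_additive.
- by move=> n; rewrite -[X in measurable X]setTI; exact: measurable_circle_pi.
- apply/trivIsetP => /= i j _ _ ij; rewrite -preimage_setI.
  by move/trivIsetP : tF => /(_ _ _ _ _ ij) ->//; rewrite preimage_set0.
- rewrite -preimage_bigcup -[X in measurable X]setTI.
  exact: measurable_circle_pi.
Qed.

HB.instance Definition _ := isMeasure.Build _ _ _ circle_measure
  circle_measure0 circle_measure_ge0 circle_measure_sigma_additive.

Let circle_measure_fin : fin_num_fun circle_measure.
Proof.
apply: lty_fin_num_fun.
rewrite /= /circle_measure /pushforward /mrestr preimage_setT setTI.
by rewrite lebesgue_measure_itv/= lte_fin; case: ifP => // _; rewrite ltry.
Qed.

HB.instance Definition _ := Measure_isFinite.Build _ _ _ circle_measure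
  circle_measure_fin.

Definition torus3_measure : {measure set (circle * circle * circle)%type -> \bar R} :=
  (circle_measure \x circle_measure \x circle_measure)%E.

End Circle.

Section Haar.
Variable R : realType.
Local Notation mR := (measurableTypeR R).

Definition lebesgue3 : {measure set (mR * mR * mR) -> \bar R} :=
  (@lebesgue_measure R \x @lebesgue_measure R \x @lebesgue_measure R)%E.

Definition euler3 (t : mR * mR * mR) : SO3 R := euler t.1.1 t.1.2 t.2.

Let measurable_euler3_entry i j :
  measurable_fun [set: mR * mR * mR] (fun t => val (euler3 t) i j).
Proof.
have mf1 : measurable_fun [set: mR * mR * mR] (fun t => t.1.1).
  exact: (measurableT_comp measurable_fst measurable_fst).
have mf2 : measurable_fun [set: mR * mR * mR] (fun t => t.1.2).
  exact: (measurableT_comp measurable_snd measurable_fst).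
have mf3 : measurable_fun [set: mR * mR * mR] (fun t => t.2).
  exact: measurable_snd.
have mcos (g : mR * mR * mR -> R) :
    measurable_fun setT g -> measurable_fun setT (fun t => cos (g t)).
  move=> mg; apply: measurableT_comp mg.
  by apply: continuous_measurable_fun; exact: continuous_cos.
have msin (g : mR * mR * mR -> R) :
    measurable_fun setT g -> measurable_fun setT (fun t => sin (g t)).
  move=> mg; apply: measurableT_comp mg.
  by apply: continuous_measurable_fun; exact: continuous_sin.
have mmul m n p (A : mR * mR * mR -> 'M[R]_(m, n))
    (B : mR * mR * mR -> 'M[R]_(n, p)) :
    (forall i j, measurable_fun setT (fun t => A t i j)) ->
    (forall i j, measurable_fun setT (fun t => B t i j)) ->
    forall i j, measurable_fun setT (fun t => (A t *m B t) i j).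
  move=> mA mB k l; under eq_fun do rewrite mxE.
  by apply: measurable_sum => h; exact: measurable_funM.
have mRz (g : mR * mR * mR -> R) : measurable_fun setT g ->
    forall i j, measurable_fun setT (fun t => Rz (g t) i j).
  move=> mg k l; under eq_fun do rewrite mxE.
  case: k => [[|[|[|//]]] ?]; case: l => [[|[|[|//]]] ?] /=;
    by first [exact: measurable_cst | exact: mcos | exact: msin
             | apply: (measurableT_comp (@oppr_measurable R setT)); exact: msin].
have mRy (g : mR * mR * mR -> R) : measurable_fun setT g ->
    forall i j, measurable_fun setT (fun t => Ry (g t) i j).
  move=> mg k l; under eq_fun do rewrite mxE.
  case: k => [[|[|[|//]]] ?]; case: l => [[|[|[|//]]] ?] /=;
    by first [exact: measurable_cst | exact: mcos | exact: msin
             | apply: (measurableT_comp (@oppr_measurable R setT)); exact: msin].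
apply: (mmul _ _ _ (fun t => Rz t.1.1 *m Ry t.1.2) (fun t => Rz t.2));
  last exact: mRz.
by apply: mmul; [exact: mRz|exact: mRy].
Qed.

(* every open set of matrices is a countable union of rational boxes *)
Lemma measurable_euler3 : measurable_fun [set: mR * mR * mR] euler3.
Proof.
apply: (@measurability _ _ _ _ _ _ (@open (SO3 R))) => // _ [U [V oV <-] <-].
rewrite setTI.
pose box (q : 'M[rat * rat]_3) : set 'M[R]_3 :=
  [set A | forall i j, A i j \in `](ratr (q i j).1), (ratr (q i j).2)[].
pose F (q : 'M[rat * rat]_3) := if `[< box q `<=` V >] then
  euler3 @^-1` (set_val @^-1` box q) else set0.
have -> : euler3 @^-1` (set_val @^-1` V) = \bigcup_q F q.
  apply/seteqP; split=> [t /= Vt|t [q _]]; last first.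
    by rewrite /F; case: asboolP => // /[apply].
  have /= : nbhs (val (euler3 t)) V by exact: open_nbhs_nbhs.
  move=> [P nP PV].
  have H i j : exists q : rat * rat,
      (val (euler3 t) i j \in `](ratr q.1), (ratr q.2)[) /\
      [set` `](ratr q.1 : R), (ratr q.2)[ ] `<=` P i j.
    have /nbhs_ballP[e /= e0 eP] := nP i j.
    set x := val (euler3 t) i j in eP *.
    have /rat_in_itvoo[p] : x - e < x by rewrite ltrBlDr ltrDl.
    have /rat_in_itvoo[q] : x < x + e by rewrite ltrDl.
    rewrite !in_itv/= => /andP[xq qx] /andP[xp px].
    exists (p, q) => /=; split; first by rewrite in_itv/= px xq.
    move=> y /=; rewrite in_itv/= => /andP[py yq]; apply: eP.
    rewrite /ball/= distrC ltr_distl; apply/andP; split.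
      exact: lt_trans py.
    exact: lt_trans qx.
  have /choice[q Hq] : forall ij, exists q : rat * rat,
      (val (euler3 t) ij.1 ij.2 \in `](ratr q.1), (ratr q.2)[) /\
      [set` `](ratr q.1 : R), (ratr q.2)[ ] `<=` P ij.1 ij.2.
    by move=> [i j]; exact: H.
  exists (\matrix_(i, j) q (i, j)) => //; rewrite /F; case: asboolP.
    by move=> _ i j; rewrite mxE; have [] := Hq (i, j).
  case=> A Abox; apply: PV => i j; have [_] := Hq (i, j); apply => /=.
  by have := Abox i j; rewrite mxE.
apply: countable_bigcupT_measurable => // q; rewrite /F; case: asboolP => // _.
rewrite (_ : _ @^-1` _ = \bigcap_(ij in [set: 'I_3 * 'I_3])
    (fun t => val (euler3 t) ij.1 ij.2) @^-1`
       `](ratr (q ij.1 ij.2).1 : R), (ratr (q ij.1 ij.2).2)[).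
  apply: fin_bigcap_measurable => // ij _; rewrite -[X in measurable X]setTI.
  by apply: measurable_euler3_entry => //; exact: measurable_itv.
by apply/seteqP; split=> [t /= Ht [i j] _|t /= Ht i j]; [exact: Ht|exact: (Ht (i, j))].
Qed.

Definition euler_box : set (mR * mR * mR) :=
  `[0, pi *+ 2[ `*` `[0, pi] `*` `[0, pi *+ 2[.

Lemma measurable_euler_box : measurable euler_box.
Proof. by do 2?apply: measurableX; exact: measurable_itv. Qed.

Definition haar_density (t : mR * mR * mR) : R := sin t.1.2 / (8 * pi ^+ 2).

(* Haar probability measure of SO(3), pushed forward from Euler angles:
   d mu = sin(beta) / (8 pi^2) d alpha d beta d gamma *)
Definition haar (A : set (SO3 R)) : \bar R :=
  (\int[lebesgue3]_(t in euler_box `&` euler3 @^-1` A) (haar_density t)%:E)%E.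

Let haar_density_ge0 t : euler_box t -> (0 <= (haar_density t)%:E)%E.
Proof.
move=> [[_ /=]]; rewrite in_itv/= => bpi _; rewrite lee_fin.
by rewrite divr_ge0 ?sin_ge0_pi// mulr_ge0// sqr_ge0.
Qed.

Let measurable_haar_density : measurable_fun setT (EFin \o haar_density).
Proof.
apply/measurable_EFinP/measurable_funM => //.
apply: (@measurableT_comp _ _ _ _ _ _ (@sin R)).
  by apply: continuous_measurable_fun; exact: continuous_sin.
exact: (measurableT_comp measurable_snd measurable_fst).
Qed.

Let measurable_piece A : measurable A -> measurable (euler_box `&` euler3 @^-1` A).
Proof.
move=> mA; apply: measurableI; first exact: measurable_euler_box.
by rewrite -[X in measurable X]setTI; exact: measurable_euler3.
Qed.

Let haar0 : haar set0 = 0%E.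
Proof. by rewrite /haar preimage_set0 setI0 integral_set0. Qed.

Let haar_ge0 A : (0 <= haar A)%E.
Proof. by apply: integral_ge0 => t [/haar_density_ge0]. Qed.

Let haar_sigma_additive : semi_sigma_additive haar.
Proof.
move=> F mF tF mUF; rewrite /haar preimage_bigcup setI_bigcupr.
rewrite ge0_integral_bigcup//=.
- apply: cvg_toP => //; apply: is_cvg_nneseries => n _ _.
  by apply: integral_ge0 => t [/haar_density_ge0].
- by move=> n; exact: measurable_piece.
- exact: measurable_funTS.
- by move=> t [n _ [/haar_density_ge0]].
- apply/trivIsetP => i j _ _ ij; rewrite setIACA setIid -preimage_setI.
  by move/trivIsetP : tF => /(_ _ _ _ _ ij) ->//; rewrite preimage_set0 setI0.
Qed.

HB.instance Definition _ := isMeasure.Build _ _ _ haar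
  haar0 haar_ge0 haar_sigma_additive.

End Haar.

Section EulerAngleMap.
Variable R : realType.

Definition euler_map (t : circle R * circle R * circle R) : SO3 R :=
  euler (repr t.1.1) (repr t.1.2) (repr t.2).

Lemma euler_map_pi (a b c : R) :
  euler_map (\pi_(circle R) a, \pi_(circle R) b, \pi_(circle R) c) = euler a b c.
Proof.
have reprP x : exists m : int, repr (\pi_(circle R) x) = x + pi *+ 2 *~ m.
  have /eqmodP/= : \pi_(circle R) (repr (\pi_(circle R) x)) = \pi x by rewrite reprK.
  rewrite /mod2pi => /intrP[m /(canRL (divfK _)) h]; exists m.
  rewrite -mulrzl -h ?subrKC//.
  by rewrite mulrn_eq0/= gt_eqF ?pi_gt0.
have per (g : R -> R) x (m : int) : periodic g (pi *+ 2) ->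
    g (x + pi *+ 2 *~ m) = g x.
  move=> pg; case: m => n; first exact: periodicn.
  rewrite NegzE mulrNz -[in RHS](subrK (pi *+ 2 *~ n.+1) x).
  by rewrite -(periodicn pg n.+1).
have RzE (x : R) (m : int) : Rz (x + pi *+ 2 *~ m) = Rz x.
  apply/matrixP => i j; rewrite !mxE.
  by rewrite (per _ _ _ (@sinD2pi R)) (per _ _ _ (@cosD2pi R)).
have RyE (x : R) (m : int) : Ry (x + pi *+ 2 *~ m) = Ry x.
  apply/matrixP => i j; rewrite !mxE.
  by rewrite (per _ _ _ (@sinD2pi R)) (per _ _ _ (@cosD2pi R)).
apply: val_inj => /=.
have [ma ->] := reprP a; have [mb ->] := reprP b; have [mc ->] := reprP c.
by rewrite !RzE RyE.
Qed.

End EulerAngleMap.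

Section ComplexL2.
Context d (T : measurableType d) (R : realType).
Variable mu : {measure set T -> \bar R}.

(* measurability with respect to the Borel sigma-algebra of C = R^2 *)
Definition cmeasurable (f : T -> R[i]) : Prop :=
  measurable_fun setT (fun x => complex.Re (f x)) /\
  measurable_fun setT (fun x => complex.Im (f x)).

Definition L2 (f : T -> R[i]) : Prop := cmeasurable f /\
  (\int[mu]_x (Normc.normc (f x) ^+ 2)%:E < +oo)%E.

Definition cintegral (f : T -> R[i]) : R[i] :=
  (\int[mu]_x complex.Re (f x)) +i* (\int[mu]_x complex.Im (f x)).

Definition L2_inner (f g : T -> R[i]) : R[i] :=
  cintegral (fun x => f x * (g x)^*).

End ComplexL2.

Section Wigner.
Variable R : realType.

(* Explicit form of P_s^(a,b) for natural a, b in the standard normalization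
   P_s^(a,b)(1) = C(s+a, s) (Szego, Orthogonal Polynomials, (4.3.2)). *)
Definition jacobi (a b s : nat) : {poly R} :=
  \sum_(m < s.+1) ('C(s + a, s - m) * 'C(s + b, m))%:R *:
    ((2^-1 *: ('X - 1)) ^+ m * (2^-1 *: ('X + 1)) ^+ (s - m)).

Definition wigner_d (n : nat) (k l : int) (x : R) : R :=
  let a := `|(k - l)%R|%N in
  let b := `|(k + l)%R|%N in
  let s := (n - maxn `|k| `|l|)%N in
  let nu := if l < k then k + l else 0 in
  (-1) ^ nu * Num.sqrt 'C(2 * n - s, s + a)%:R / Num.sqrt 'C(s + b, b)%:R *
  ((1 - x) / 2) `^ (a%:R / 2) * ((1 + x) / 2) `^ (b%:R / 2) *
  (jacobi a b s).[x].

Definition expi (t : R) : R[i] := cos t +i* sin t.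

(* Arbitrary Euler angles of A.  They are unique up to 2 pi Z in alpha, gamma
   when 0 < beta < pi; for beta = 0 (resp. beta = pi) only alpha + gamma
   (resp. alpha - gamma) is determined, but then wigner_d vanishes unless
   k = l (resp. k = - l), so wigner_D does not depend on the choice. *)
Definition euler_angles (A : SO3 R) : R * R * R :=
  xget (0, 0, 0) [set t | 0 <= t.1.2 <= pi /\ euler t.1.1 t.1.2 t.2 = A].

Definition wigner_D (n : nat) (k l : int) (A : SO3 R) : R[i] :=
  let: (alpha, beta, gamma) := euler_angles A in
  (Num.sqrt (2 * n + 1)%:R)%:C * expi (- (k%:~R * alpha)) *
  (wigner_d n k l (cos beta))%:C * expi (- (l%:~R * gamma)).

Definition harmonic_coef (f : SO3 R -> R[i]) (n : nat) (k l : int) : R[i] :=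
  L2_inner (@haar R) f (wigner_D n k l).

(* the indices i, j < 2n+1 encode k = i - n and l = j - n *)
Definition sobolev (s : R) (f : SO3 R -> R[i]) : Prop :=
  L2 (@haar R) f /\
  (\sum_(0 <= n <oo)
    (\sum_(i < (2 * n).+1) \sum_(j < (2 * n).+1)
      (1 + n * (n + 1))%:R `^ s *
      Normc.normc (harmonic_coef f n (i%:Z - n%:Z) (j%:Z - n%:Z)) ^+ 2)%:E
   < +oo)%E.

End Wigner.

(* Main.v *)
(* Only beta matters: f = (sin beta)^(-1/2), so |f|^2 sin beta is bounded while
   |f|^2 = 1 / sin beta is not integrable over the torus.  The coefficients
   with (k, l) <> (0, 0) vanish by integrating over alpha or gamma, and the
   remaining one is sqrt(2n+1) / 2 times
   c_n = int_0^pi sqrt(sin beta) P_n(cos beta) d beta.  Integrating the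
   derivative of sin^(3/2) P_(n+1)(cos) and combining the recurrences for
   x P_(n+1) and (1 - x^2) P_(n+1)' gives
   (n+2)(n+5/2) c_(n+2) = (n+1)(n+1/2) c_n, hence c_n = O(n^(-3/2)), and the
   Sobolev series is dominated by sum_n (n+1)^(2s-2). *)
From HB Require Import structures.
Require Import Defs.
From mathcomp Require Import all_boot all_order all_algebra.
From mathcomp Require Import all_classical all_reals all_analysis.
From mathcomp Require Import measurable_realfun complex ring lra.

Set Implicit Arguments.
Unset Strict Implicit.
Unset Printing Implicit Defensive.

Import Order.TTheory GRing.Theory Num.Theory.
Import numFieldNormedType.Exports.

Local Open Scope classical_set_scope.
Local Open Scope ring_scope.
Local Open Scope complex_scope.

(** [wigner_D] picks Euler angles by choice, so its definition gives no measurability. The product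
    of [f] with the conjugate of [wigner_D] is therefore shown to equal, everywhere, an explicit
    function of the matrix entries. This works because [f] is 0 at the poles beta = 0 and beta = pi,
    exactly where the entries no longer determine exp(i alpha) and exp(i gamma). The moment
    recurrence is proved in one stroke: the explicit sum for P_n is homogeneous in (x-1)/2 and
    (x+1)/2, and comparing coefficients leaves one algebraic relation between three neighbouring
    binomial coefficients. Its factor is about 1 - 3/n over two steps, whence the exponent -3/2;
    with the weight n^(2s) and the normalization 2n+1 this gives the threshold s < 1/2. *)

(** * Legendre polynomials as homogeneous forms in (x-1)/2 and (x+1)/2 *)

Section HomogeneousPolynomials.
Variable R : realType.
Implicit Types f : nat -> R.

Let u : {poly R} := 2^-1 *: ('X - 1).
Let v : {poly R} := 2^-1 *: ('X + 1).

(* Legendre polynomials have coefficients 'C(n, m) ^+ 2 in this form, and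
   v - u = 1 allows comparing forms of different degrees. *)
Definition hform (n : nat) f : {poly R} :=
  \sum_(m < n.+1) f m *: (u ^+ m * v ^+ (n - m)).

Let halfX : (2^-1)%:P * 2 = 1 :> {poly R}.
Proof. by rewrite -polyC_natr -polyCM mulVf// pnatr_eq0. Qed.

Let vBu : v - u = 1.
Proof. by rewrite /u /v -!mul_polyC; ring: halfX. Qed.

Let vDu : v + u = 'X.
Proof. by rewrite /u /v -!mul_polyC; ring: halfX. Qed.

Let du : u^`() = (2^-1)%:P.
Proof. by rewrite /u derivZ derivB derivX derivC subr0 alg_polyC. Qed.

Let dv : v^`() = (2^-1)%:P.
Proof. by rewrite /v derivZ derivD derivX derivC addr0 alg_polyC. Qed.

Let uvE : 1 - 'X^2 = - (4%:P * (u * v)).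
Proof.
have -> : 4%:P = 4 :> {poly R} by rewrite polyC_natr.
transitivity ((v - u) ^+ 2 - (v + u) ^+ 2); first by rewrite vBu vDu expr1n.
by move: u v => a b; ring.
Qed.

Lemma eq_hform n f g : (forall m, (m <= n)%N -> f m = g m) ->
  hform n f = hform n g.
Proof. by move=> fg; apply: eq_bigr => m _; rewrite fg// -ltnS. Qed.

Lemma hformD n f g : hform n f + hform n g = hform n (fun m => f m + g m).
Proof. by rewrite -big_split/=; apply: eq_bigr => m _; rewrite scalerDl. Qed.

Lemma hformZ n a f : a *: hform n f = hform n (fun m => a * f m).
Proof. by rewrite scaler_sumr; apply: eq_bigr => m _; rewrite scalerA. Qed.

Lemma hformB n f g : hform n f - hform n g = hform n (fun m => f m - g m).
Proof.
rewrite -scaleN1r hformZ hformD; apply: eq_hform => m _.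
by rewrite mulN1r.
Qed.

(** [hform n] does not read [f n.+1] but [hform n.+1] does, hence the vanishing condition on that
    coefficient. *)
Lemma mulv_hform n f : f n.+1 = 0 -> v * hform n f = hform n.+1 f.
Proof.
move=> fn; rewrite /hform [RHS]big_ord_recr/= fn scale0r addr0 mulr_sumr.
apply: eq_bigr => m _; rewrite -scalerAr; congr (_ *: _).
by rewrite mulrCA -exprS subSn// -ltnS.
Qed.

Definition rshift f m := if m is m'.+1 then f m' else 0.

Lemma mulu_hform n f : u * hform n f = hform n.+1 (rshift f).
Proof.
rewrite /hform [RHS]big_ord_recl/= scale0r add0r mulr_sumr.
apply: eq_bigr => m _; rewrite -scalerAr; congr (_ *: _).
by rewrite mulrA -exprS.
Qed.

Lemma mulX_hform n f : f n.+1 = 0 ->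
  'X * hform n f = hform n.+1 (fun m => f m + rshift f m).
Proof. by move=> fn; rewrite -vDu mulrDl mulv_hform// mulu_hform hformD. Qed.

(* Multiplication by 1 = (v - u) ^+ 2. *)
Lemma hform_raise2 n f : (forall m, (n < m)%N -> f m = 0) ->
  hform n f = hform n.+2 (fun m => f m - 2 * rshift f m + rshift (rshift f) m).
Proof.
move=> fn; have raise g k : g k.+1 = 0 ->
    hform k g = hform k.+1 (fun m => g m - rshift g m).
  move=> gk; rewrite -hformB -mulu_hform -mulv_hform//.
  by rewrite -mulrBl vBu mul1r.
rewrite (raise f) ?fn// raise; last by rewrite /= !fn ?subr0.
by apply: eq_hform => -[|[|m]] _ /=; ring.
Qed.

(** Since u' = v' = 1/2 and 1 - X^2 = -4uv, the monomial u^m v^k is sent to -2 (m u^m v^(k+1) + k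
    u^(m+1) v^k), which is again homogeneous, of degree one more. *)
Lemma hform_deriv n f : f n.+1 = 0 ->
  (1 - 'X^2) * (hform n f)^`() =
  - 2 *: hform n.+1 (fun m => m%:R * f m + rshift (fun m => (n%:R - m%:R) * f m) m).
Proof.
move=> fn; rewrite -hformD -mulu_hform -mulv_hform ?fn ?mulr0//.
rewrite uvE /hform linear_sum /= !mulr_sumr -big_split/= scaler_sumr.
apply: eq_bigr => -[m mn] _ /=; rewrite derivZ derivM !deriv_exp du dv.
have [k nE] : exists k, n = (m + k)%N by exists (n - m)%N; rewrite subnKC// -ltnS.
rewrite nE addKn natrD (addrC m%:R) addrK -!mul_polyC !polyCM !polyC_natr.
rewrite !polyCN.
rewrite -!(mulr_natr (_ * _)).
(* The truncated predecessor is harmless: at m = 0 both sides are 0. *)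
have um : u * (m%:R * u ^+ m.-1) = m%:R * u ^+ m.
  by case: (m) => [|j]; rewrite ?mul0r ?mulr0// mulrCA -exprS.
have vk : v * (k%:R * v ^+ k.-1) = k%:R * v ^+ k.
  by case: (k) => [|j]; rewrite ?mul0r ?mulr0// mulrCA -exprS.
transitivity (- (2 * (f m)%:P) * ((2^-1)%:P * 2) *
   (v * (u * (m%:R * u ^+ m.-1)) * v ^+ k + u * u ^+ m * (v * (k%:R * v ^+ k.-1)))).
  by ring.
by rewrite um vk halfX !polyC_natr; ring.
Qed.

End HomogeneousPolynomials.

Section Legendre.
Variable R : realType.

Definition sqbin (n m : nat) : R := 'C(n, m)%:R ^+ 2.

Lemma jacobi00E n : jacobi R 0 0 n = hform n (sqbin n).
Proof.
apply: eq_bigr => -[m /=]; rewrite ltnS => mn _.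
by rewrite !addn0 bin_sub// natrM -expr2.
Qed.

(** Subtraction is taken in [R]: for m > n the sign of n - m is irrelevant because both binomials
    vanish. *)
Lemma binSr (n m : nat) :
  m.+1%:R * 'C(n, m.+1)%:R = (n%:R - m%:R) * 'C(n, m)%:R :> R.
Proof.
have [mn|nm] := leqP m n; last by rewrite !bin_small ?mulr0// ltnW.
by rewrite -natrB// -!natrM mul_bin_left.
Qed.

Lemma sqbin_small n m : (n < m)%N -> sqbin n m = 0.
Proof. by move=> nm; rewrite /sqbin bin_small// expr0n. Qed.

(** The bracket on the left has the shape treated in [sqrt_sin_moment_exact], so taking moments
    leaves a two-term recurrence. All terms are written as forms of degree n+2, where it suffices to
    compare coefficients. *)
Lemma legendre_rec n :
  let P := jacobi R 0 0 in
  (2 * n%:R + 3) *: ((3 / 2) *: ('X * P n.+1) - (1 - 'X^2) * (P n.+1)^`()) =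
  ((n%:R + 2) * (n%:R + 5 / 2)) *: P n.+2
  - ((n%:R + 1) * (n%:R + 1 / 2)) *: P n.
Proof.
rewrite /= !jacobi00E.
rewrite (@hform_raise2 _ n); last exact: sqbin_small.
rewrite mulX_hform; last exact: sqbin_small.
rewrite hform_deriv; last exact: sqbin_small.
rewrite !hformZ !hformB hformZ; apply: eq_hform => m _.
have binSn k j : 'C(k.+1, j.+1)%:R = 'C(k, j.+1)%:R + 'C(k, j)%:R :> R.
  by rewrite binS natrD.
(* Here p, q, r stand for C(n,m), C(n,m-1), C(n,m-2); Pascal's rule gives p+q and q+r in row n+1 and
   p+2q+r in row n+2. The two hypotheses are the ratios of neighbours in row n. *)
have key (p q r M N : R) : M * p = (N + 1 - M) * q ->
    (M - 1) * q = (N + 2 - M) * r ->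
    (2 * N + 3) * (3 / 2 * ((p + q) ^+ 2 + (q + r) ^+ 2) -
      - 2 * (M * (p + q) ^+ 2 + (N + 1 - (M - 1)) * (q + r) ^+ 2)) =
    (N + 2) * (N + 5 / 2) * (p + q + (q + r)) ^+ 2 -
    (N + 1) * (N + 1 / 2) * (p ^+ 2 - 2 * q ^+ 2 + r ^+ 2).
  move=> /eqP; rewrite -subr_eq0 => /eqP e1 /eqP; rewrite -subr_eq0 => /eqP e2.
  apply/eqP; rewrite -subr_eq0; apply/eqP.
  (* A certificate: the difference of the two sides is a combination of the two ratio relations with
     explicit polynomial cofactors. *)
  transitivity
    ((- 3 * (q + r) + 2 * ((2 * N + 3) * p + (N + 2) * q - (N + 1) * r)) *
       (M * p - (N + 1 - M) * q) +
     (3 * (p + q) + 2 * ((N + 1) * p - (N + 2) * q - (2 * N + 3) * r)) *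
       ((M - 1) * q - (N + 2 - M) * r)); last by rewrite e1 e2 !mulr0 addr0.
  by field.
(* For m = 0 and m = 1 the binomials with negative lower index are replaced by 0. *)
case: m => [|[|m]]; rewrite /sqbin /rshift.
- have H := key 1 0 0 0 n%:R ltac:(ring) ltac:(ring).
  by rewrite !bin0; apply: etrans (etrans H _); field.
- have := key n%:R 1 0 1 n%:R.
  rewrite !bin0 !bin1 -!natr1 => H; have {}H := H ltac:(ring) ltac:(ring).
  apply: etrans (etrans H _); by field.
- have := key 'C(n, m.+2)%:R 'C(n, m.+1)%:R 'C(n, m)%:R m.+2%:R n%:R.
  have e1 := binSr n m.+1; have e2 := binSr n m.
  rewrite !binSn; move: e1 e2; rewrite -!natr1 => e1 e2 H.
  have {}H := H ltac:(rewrite e1; ring) ltac:(by rewrite addrK e2; ring).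
  apply: etrans (etrans H _); by field.
Qed.

End Legendre.

(** * Moments of Legendre polynomials against the square root of the sine *)

Section LegendreMoments.
Variable R : realType.
Local Notation mu := (@lebesgue_measure R).

(** The weight is what remains of [f] times the Haar density: (sin x)^(-1/2) sin x. *)
Definition sqrt_sin_moment (p : {poly R}) : R :=
  \int[mu]_(x in `[0, pi]) (Num.sqrt (sin x) * p.[cos x]).

Lemma continuous_sqrt_sin_horner (p : {poly R}) :
  continuous (fun x : R => Num.sqrt (sin x) * p.[cos x]).
Proof.
move=> x; apply: cvgM.
  by apply: (@continuous_comp _ _ _ sin Num.sqrt);
    [exact: continuous_sin|exact: sqrt_continuous].
by apply: (@continuous_comp _ _ _ cos (horner p));
  [exact: continuous_cos|exact: continuous_horner].
Qed.

Lemma integrable_sqrt_sin_horner (p : {poly R}) :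
  mu.-integrable `[0, pi] (fun x => (Num.sqrt (sin x) * p.[cos x])%:E).
Proof.
apply: continuous_compact_integrable; first exact: segment_compact.
exact/continuous_subspaceT/continuous_sqrt_sin_horner.
Qed.

Lemma sqrt_sin_momentD p q :
  sqrt_sin_moment (p + q) = sqrt_sin_moment p + sqrt_sin_moment q.
Proof.
rewrite /sqrt_sin_moment -RintegralD//; [|exact: integrable_sqrt_sin_horner..].
by apply: eq_Rintegral => x _; rewrite hornerD mulrDr.
Qed.

Lemma sqrt_sin_momentZ a p : sqrt_sin_moment (a *: p) = a * sqrt_sin_moment p.
Proof.
rewrite /sqrt_sin_moment -RintegralZl//; last exact: integrable_sqrt_sin_horner.
by apply: eq_Rintegral => x _; rewrite hornerZ mulrCA.
Qed.

Lemma sqrt_sin_momentB p q :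
  sqrt_sin_moment (p - q) = sqrt_sin_moment p - sqrt_sin_moment q.
Proof. by rewrite -scaleN1r sqrt_sin_momentD sqrt_sin_momentZ mulN1r. Qed.

(* The integrand is the derivative of sin^(3/2) q(cos). *)
Lemma sqrt_sin_moment_exact (q : {poly R}) :
  sqrt_sin_moment ((3 / 2) *: ('X * q) - (1 - 'X^2) * q^`()) = 0.
Proof.
pose F (x : R) := sin x * (Num.sqrt (sin x) * q.[cos x]).
have cF : continuous F.
  move=> x; apply: cvgM; [exact: continuous_sin|exact: continuous_sqrt_sin_horner].
(* The chain rule through the square root needs sin x > 0; at the endpoints only continuity of [F]
   is used. *)
have dF (x : R) : x \in `]0, pi[ -> is_derive x 1 F
    (Num.sqrt (sin x) * ((3 / 2) *: ('X * q) - (1 - 'X^2) * q^`()).[cos x]).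
  rewrite in_itv/= => /sin_gt0_pi s0.
  have ds := is_derive1_comp (is_derive1_sqrt s0) (is_derive_sin x).
  have dq := is_derive1_comp (is_derive_poly q (cos x)) (is_derive_cos x).
  apply: is_derive_eq.
  have s2 := sqr_sqrtr (ltW s0).
  have c2 : 1 - cos x ^+ 2 = sin x ^+ 2 by rewrite -(cos2Dsin2 x) addrC addKr.
  have : Num.sqrt (sin x) != 0 by rewrite gt_eqF ?sqrtr_gt0.
  rewrite !hornerE/= c2 /GRing.scale/=.
  by move: (Num.sqrt (sin x)) s2 => r <- r0; field.
rewrite /sqrt_sin_moment /Rintegral (@continuous_FTC2 _ _ F) ?pi_gt0//.
- by rewrite /F sin0 sinpi !mul0r /= subr0.
- exact/continuous_subspaceT/continuous_sqrt_sin_horner.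
- split=> [x /dF[]//| |].
  + by apply: cvg_at_right_filter; exact: cF.
  + by apply: cvg_at_left_filter; exact: cF.
- by move=> x /dF h; rewrite derive1E derive_val.
Qed.

Definition legendre_moment n := sqrt_sin_moment (jacobi R 0 0 n).

Lemma legendre_moment_rec n :
  (n%:R + 2) * (n%:R + 5 / 2) * legendre_moment n.+2 =
  (n%:R + 1) * (n%:R + 1 / 2) * legendre_moment n.
Proof.
apply/eqP; rewrite -subr_eq0 -!sqrt_sin_momentZ -sqrt_sin_momentB.
by rewrite -legendre_rec sqrt_sin_momentZ sqrt_sin_moment_exact mulr0.
Qed.

Lemma legendre_moment_bound : exists2 K : R, 0 <= K &
  forall n, legendre_moment n ^+ 2 * (n%:R + 1 / 2) ^+ 2 * (n%:R + 1) <= K.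
Proof.
pose e n := legendre_moment n ^+ 2 * (n%:R + 1 / 2) ^+ 2 * (n%:R + 1).
have e0 n : 0 <= e n.
  by rewrite /e; do 2?apply: mulr_ge0; rewrite ?sqr_ge0.
(* The recurrence links indices of equal parity, so [e] decreases along evens and along odds, and
   both starting values enter the bound. *)
exists (e 0 + e 1)%R; first exact: addr_ge0.
(* After inserting the recurrence this reduces to (N+1)(N+3) <= (N+2)^2. *)
have step n : e n.+2 <= e n.
  have n0 : 0 <= n%:R :> R by [].
  have n2 : n.+2%:R = n%:R + 2 :> R by rewrite -natrD addn2.
  have := legendre_moment_rec n; rewrite /e n2; move: {n2} (n%:R : R) n0 => N N0.
  move: (legendre_moment n) (legendre_moment n.+2) => c c' H.
  have H' : c' * (N + 5 / 2) = (N + 1) / (N + 2) * ((N + 1 / 2) * c).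
    have N2 : N + 2 != 0 by lra.
    apply: (mulfI N2); transitivity ((N + 2) * (N + 5 / 2) * c'); first by ring.
    by rewrite H; field.
  rewrite (_ : _ * _ * _ = (c' * (N + 5 / 2)) ^+ 2 * (N + 3)); last by field.
  rewrite {}H' exprMn mulrAC.
  rewrite (_ : _ * _ * (N + 1) = (N + 1) * ((N + 1 / 2) * c) ^+ 2); last by ring.
  rewrite ler_wpM2r ?sqr_ge0// expr_div_n mulrAC ler_pdivrMr ?exprn_gt0//; last lra.
  nra.
have both n : e n <= e 0 + e 1 /\ e n.+1 <= e 0 + e 1.
  elim: n => [|n [h1 h2]]; first by rewrite lerDl lerDr !e0.
  by split=> //; apply: le_trans h1.
by move=> n; have [] := both n.
Qed.

End LegendreMoments.

(** * Convergence of the Sobolev series *)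

Section Series.
Variable R : realType.


(** A telescoping majorant. From ln(x/(x+1)) <= -1/(x+1) and 1+y <= exp y with y = q/(x+1), the
    difference on the right is at least x^(-q) q/(x+1+q). The constant 3 comes from x+1+q <= 3x,
    valid for x >= 1 and q <= 1. *)
Lemma powRN_step (q x : R) : 0 < q <= 1 -> 1 <= x ->
  x `^ (- (1 + q)) <= 3 / q * (x `^ (- q) - (x + 1) `^ (- q)).
Proof.
move=> /andP[q0 q1] x1; have x0 : 0 < x by lra.
pose y : R := q / (x + 1).
have y0 : 0 < y by rewrite divr_gt0//; lra.
have h : (x + 1) `^ (- q) <= x `^ (- q) / (1 + y).
  have x1P : 0 < x + 1 by lra.
  have d1 : 0 < 1 + y by lra.
  rewrite ler_pdivlMr// /powR !gt_eqF// -ler_pdivlMl ?expR_gt0// -expRN -expRD.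
  apply: le_trans (expR_ge1Dx y) _; rewrite ler_expR.
  have : ln (x / (x + 1)) <= - (x + 1)^-1.
    rewrite (_ : x / (x + 1) = 1 + - (x + 1)^-1); last by field; lra.
    apply: le_ln1Dx; rewrite ltrN2 invf_lt1//; lra.
  rewrite ln_div ?posrE// -(ler_pM2l q0) mulrN -/y => h.
  by rewrite mulNr opprK mulNr; move: h; lra.
have -> : x `^ (- (1 + q)) = x^-1 * x `^ (- q).
  rewrite opprD powRD; last by rewrite (gt_eqF x0) implybT.
  by rewrite powR_inv1// ltW.
have a0 : 0 <= x `^ (- q) by exact: powR_ge0.
apply: (@le_trans _ _ (3 / q * (x `^ (- q) - x `^ (- q) / (1 + y)))); last first.
  by rewrite ler_pM2l ?divr_gt0// lerD2l lerN2.
rewrite (_ : 3 / q * _ = 3 / (x + 1 + q) * x `^ (- q)); last by rewrite /y; field; lra.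
rewrite ler_wpM2r// -[leLHS]div1r ler_pdivrMr// mulrAC ler_pdivlMr; lra.
Qed.

Lemma powRN_series_bound (q : R) N : 0 < q <= 1 ->
  \sum_(0 <= n < N) n.+1%:R `^ (- (1 + q)) <= 3 / q.
Proof.
move=> q01; have /andP[q0 _] := q01.
(* The claim is strengthened by the telescoped remainder so that the induction closes. *)
apply: (@le_trans _ _ (3 / q * (1 - N.+1%:R `^ (- q)))); last first.
  rewrite ger_pMr ?divr_gt0// gerBl; exact: powR_ge0.
elim: N => [|N IH]; first by rewrite big_geq// powR1 subrr mulr0.
rewrite big_nat_recr//=; apply: le_trans (lerD IH (powRN_step q01 _)) _.
  by rewrite ler1n.
by rewrite -mulrDr subrKA natr1.
Qed.

Lemma nneseries_lty (u : nat -> R) (M : R) : (forall n, 0 <= u n) ->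
  (forall N, \sum_(0 <= n < N) u n <= M) -> (\sum_(0 <= n <oo) (u n)%:E < +oo)%E.
Proof.
move=> u0 uM; apply: (@le_lt_trans _ _ M%:E); last exact: ltry.
apply: lime_le; first by apply: is_cvg_nneseries => n _ _; rewrite lee_fin.
by apply: nearW => N; rewrite sumEFin lee_fin.
Qed.

Lemma legendre_series (s : R) : 0 <= s < 2^-1 ->
  (\sum_(0 <= n <oo) ((1 + n * (n + 1))%:R `^ s *
     (Num.sqrt (2 * n + 1)%:R / 2 * legendre_moment R n) ^+ 2)%:E < +oo)%E.
Proof.
move=> /andP[s0 s2]; have [K K0 HK] := legendre_moment_bound R.
(* With this choice -(1+q) = 2s-2, and 0 <= s < 1/2 becomes 0 < q <= 1. *)
pose q : R := 1 - 2 * s.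
have q01 : 0 < q <= 1 by rewrite /q; apply/andP; split; lra.
have term n : (1 + n * (n + 1))%:R `^ s *
    (Num.sqrt (2 * n + 1)%:R / 2 * legendre_moment R n) ^+ 2
    <= K * n.+1%:R `^ (- (1 + q)).
  have n0 : 0 <= n%:R :> R by [].
  have -> : n.+1%:R `^ (- (1 + q)) = n.+1%:R `^ (2 * s) / n.+1%:R ^+ 2 :> R.
    rewrite (_ : - (1 + q) = 2 * s - 2); last by rewrite /q; lra.
    by rewrite powRB ?pnatr_eq0 ?implybT// powR_mulrn.
  (* Two separate bounds: 1 + n(n+1) <= (n+1)^2, and (2n+1)/4 (n+1)^2 <= (n+1/2)^2 (n+1), which
     amounts to n+1 <= 2n+1. *)
  rewrite [leRHS]mulrCA ler_pM ?powR_ge0 ?sqr_ge0//.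
    rewrite powRrM powR_mulrn// ge0_ler_powR// ?nnegrE// -natrX ler_nat.
    by rewrite addn1 -mulnn mulSn leq_add2r.
  have -> : n.+1%:R = n%:R + 1 :> R by rewrite natr1.
  rewrite exprMn expr_div_n sqr_sqrtr// natrD natrM.
  have := HK n; move: (legendre_moment R n) (n%:R : R) n0 => c x x0.
  rewrite ler_pdivlMr ?exprn_gt0//; last lra.
  nra.
apply: (@nneseries_lty _ (K * (3 / q))) => [n|N].
  by rewrite mulr_ge0 ?powR_ge0 ?sqr_ge0.
apply: le_trans (ler_sum _ (fun n _ => term n)) _.
rewrite -mulr_sumr ler_wpM2l//; exact: powRN_series_bound.
Qed.

End Series.

(** * Every rotation has Euler angles *)

Section EulerSurjective.
Variable R : realType.
Implicit Types A B : 'M[R]_3.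

Local Notation i0 := (ord0 : 'I_3).
Local Notation i1 := (lift ord0 ord0 : 'I_3).
Local Notation i2 := (lift ord0 (lift ord0 ord0) : 'I_3).

Lemma I3_ind (P : 'I_3 -> Prop) : P i0 -> P i1 -> P i2 -> forall i, P i.
Proof.
move=> P0 P1 P2 [[|[|[|//]]] h].
- by rewrite (_ : Ordinal h = i0)//; exact/val_inj.
- by rewrite (_ : Ordinal h = i1)//; exact/val_inj.
- by rewrite (_ : Ordinal h = i2)//; exact/val_inj.
Qed.

Lemma euler_entries (a b c : R) (E := val (euler a b c)) :
  [/\ E i0 i2 = cos a * sin b, E i1 i2 = sin a * sin b, E i2 i2 = cos b,
      E i2 i0 = - (sin b * cos c) & E i2 i1 = sin b * sin c].
Proof.
rewrite /E /euler/=; split; rewrite !(mxE, big_ord_recl, big_ord0)/=; ring.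
Qed.

(** The arccosine of x/r fixes the angle up to sign, and the sign of y decides; for r = 0 any angle
    serves. *)
Lemma polar_coordinates (x y r : R) : 0 <= r -> x ^+ 2 + y ^+ 2 = r ^+ 2 ->
  exists a : R, x = cos a * r /\ y = sin a * r.
Proof.
rewrite le_eqVlt => /predU1P[<-|r0] xyr.
  exists 0; rewrite !mulr0; move/eqP: xyr.
  by rewrite expr0n/= paddr_eq0 ?sqr_ge0// !sqrf_eq0 => /andP[/eqP -> /eqP ->].
have xr : (x / r) ^+ 2 + (y / r) ^+ 2 = 1.
  by rewrite !expr_div_n -mulrDl xyr divff// expf_neq0// gt_eqF.
have x1 : -1 <= x / r <= 1.
  by rewrite -ler_norml -(@ler_pXn2r _ 2) ?nnegrE// expr1n real_normK ?num_real//; nra.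
have cx : cos (acos (x / r)) = x / r by rewrite acosK// in_itv.
have sx : sin (acos (x / r)) = `|y / r|.
  by rewrite sin_acos// -xr addrC addKr sqrtr_sqr.
have [y0|y0] := leP 0 (y / r).
  by exists (acos (x / r)); rewrite cx sx ger0_norm// !divfK ?gt_eqF.
by exists (- acos (x / r)); rewrite cosN sinN cx sx ltr0_norm// opprK !divfK ?gt_eqF.
Qed.

Lemma SO3_set_tr A : SO3_set A -> SO3_set A^T.
Proof. by move=> [AA dA]; split; [rewrite trmxK; exact: mulmx1C|rewrite det_tr]. Qed.

Lemma SO3_row A i j : SO3_set A ->
  A i i0 * A j i0 + A i i1 * A j i1 + A i i2 * A j i2 = (i == j)%:R.
Proof.
move=> /SO3_set_tr[/matrixP/(_ i j)].
by rewrite trmxK !(mxE, big_ord_recl, big_ord0)/= addr0 addrA.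
Qed.

Lemma SO3_col A i j : SO3_set A ->
  A i0 i * A i0 j + A i1 i * A i1 j + A i2 i * A i2 j = (i == j)%:R.
Proof. by move=> /SO3_set_tr/(@SO3_row _ i j); rewrite !mxE. Qed.

Lemma det3 A : \det A =
  A i0 i0 * (A i1 i1 * A i2 i2 - A i1 i2 * A i2 i1) -
  A i0 i1 * (A i1 i0 * A i2 i2 - A i1 i2 * A i2 i0) +
  A i0 i2 * (A i1 i0 * A i2 i1 - A i1 i1 * A i2 i0).
Proof.
pose F (i j : nat) := A (inord i) (inord j).
have AE : A = \matrix_(i < 3, j < 3) F i j.
  by apply/matrixP => i j; rewrite mxE /F !inord_val.
rewrite [in LHS]AE [in RHS]AE !mxE; move: F {AE} => F.
rewrite (expand_det_row _ ord0) !big_ord_recl big_ord0 /cofactor.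
rewrite !(expand_det_row _ ord0) !big_ord_recl !big_ord0 /cofactor.
by rewrite !det_mx11 !mxE /= /bump/= !expr0 ?expr1; ring.
Qed.

Lemma SO3_fix_e3 A : SO3_set A -> A i0 i2 = 0 -> A i1 i2 = 0 -> A i2 i2 = 1 ->
  exists c, A = Rz c.
Proof.
move=> SA A02 A12 A22.
have A2 : A i2 i0 ^+ 2 + A i2 i1 ^+ 2 = 0.
  by have := SO3_row i2 i2 SA; rewrite A22 eqxx/=; lra.
have [A20 A21] : A i2 i0 = 0 /\ A i2 i1 = 0.
  move/eqP: A2; rewrite paddr_eq0 ?sqr_ge0// !sqrf_eq0.
  by move=> /andP[/eqP -> /eqP ->].
have c00 := SO3_col i0 i0 SA; have c01 := SO3_col i0 i1 SA.
have [_ dA] := SA; move: c00 c01 dA; rewrite det3 A20 A21 A02 A12 A22 !eqxx/=.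
set x := A i0 i0; set y := A i1 i0; set z := A i0 i1; set w := A i1 i1.
move=> c00 c01 dA; have d : x * w - z * y = 1 by lra.
(* Orthonormality of the first two columns combined with determinant 1, as in Cramer's rule; the
   products [0 * 0] are what the vanishing third row left in [c00] and [c01]. *)
have wx : w = x.
  transitivity (w * (x * x + y * y + 0 * 0) - y * (x * z + y * w + 0 * 0));
    first by rewrite c00 c01; ring.
  by transitivity (x * (x * w - z * y)); [ring|rewrite d mulr1].
have zy : z = - y.
  transitivity (z * (x * x + y * y + 0 * 0) - x * (x * z + y * w + 0 * 0));
    first by rewrite c00 c01; ring.
  by transitivity (- y * (x * w - z * y)); [ring|rewrite d mulr1].
have /(polar_coordinates ler01)[c [xc yc]] : x ^+ 2 + y ^+ 2 = 1 ^+ 2.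
  by rewrite expr1n; apply: etrans c00; ring.
exists c; apply/matrixP.
elim/I3_ind; elim/I3_ind; rewrite mxE/= ?A20 ?A21 ?A02 ?A12 ?A22//.
- by rewrite -/x xc mulr1.
- by rewrite -/z zy yc mulr1.
- by rewrite -/y yc mulr1.
- by rewrite -/w wx xc mulr1.
Qed.

(** The third column of [A] is a unit vector with spherical coordinates (b, a). Undoing
    [Rz a *m Ry b] leaves a rotation whose third column is e3, which is some [Rz c]. *)
Lemma euler_surj (A : SO3 R) : exists t : R * R * R,
  0 <= t.1.2 <= pi /\ euler t.1.1 t.1.2 t.2 = A.
Proof.
have /set_mem SA := valP A.
have A22 : -1 <= val A i2 i2 <= 1.
  have := SO3_row i2 i2 SA; rewrite eqxx/= => h.
  by rewrite -ler_norml -(@ler_pXn2r _ 2) ?nnegrE// expr1n real_normK ?num_real//; nra.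
pose b := acos (val A i2 i2).
have cb : cos b = val A i2 i2 by rewrite acosK// in_itv.
have b0pi : 0 <= b <= pi by rewrite acos_ge0// acos_lepi.
have [a [A02 A12]] : exists a, val A i0 i2 = cos a * sin b /\ val A i1 i2 = sin a * sin b.
  apply: polar_coordinates; first exact: sin_ge0_pi.
  by rewrite sin2cos2 cb; have := SO3_col i2 i2 SA; rewrite eqxx/=; lra.
pose N := Ry (- b) *m (Rz (- a) *m val A).
have [c Nc] : exists c, N = Rz c.
  apply: SO3_fix_e3.
  - by apply: SO3_setM (SO3_set_Ry _) _; apply: SO3_setM (SO3_set_Rz _) SA.
  - rewrite /N !(mxE, big_ord_recl, big_ord0)/= A02 A12 -cb !cosN !sinN.
    transitivity (cos b * sin b * (cos a ^+ 2 + sin a ^+ 2 - 1)); first by ring.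
    by rewrite cos2Dsin2 subrr mulr0.
  - by rewrite /N !(mxE, big_ord_recl, big_ord0)/= A02 A12 -cb !cosN !sinN; ring.
  - rewrite /N !(mxE, big_ord_recl, big_ord0)/= A02 A12 -cb !cosN !sinN.
    transitivity (sin b ^+ 2 * (cos a ^+ 2 + sin a ^+ 2) + cos b ^+ 2); first by ring.
    by rewrite cos2Dsin2 mulr1 addrC cos2Dsin2.
have RzN x : Rz x *m Rz (- x) = 1%:M :> 'M[R]_3.
  have [h _] := SO3_set_tr (SO3_set_Rz x); rewrite trmxK in h.
  rewrite -h; congr (_ *m _); apply/matrixP.
  by elim/I3_ind; elim/I3_ind; rewrite !mxE/= ?cosN ?sinN ?opprK.
have RyN x : Ry x *m Ry (- x) = 1%:M :> 'M[R]_3.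
  have [h _] := SO3_set_tr (SO3_set_Ry x); rewrite trmxK in h.
  rewrite -h; congr (_ *m _); apply/matrixP.
  by elim/I3_ind; elim/I3_ind; rewrite !mxE/= ?cosN ?sinN ?opprK.
exists (a, b, c); split=> //; apply: val_inj => /=; rewrite -Nc /N.
by rewrite -!mulmxA (mulmxA (Ry b)) RyN mul1mx mulmxA RzN mul1mx.
Qed.

End EulerSurjective.

(** * Measurability of complex functions and of exponentials of angles *)

Section ComplexMeasurability.
Context d (T : measurableType d) (R : realType).
Implicit Types f g : T -> R[i].

Lemma cReM (x y : R[i]) :
  complex.Re (x * y) = complex.Re x * complex.Re y - complex.Im x * complex.Im y.
Proof. by case: x; case: y. Qed.

Lemma cImM (x y : R[i]) :
  complex.Im (x * y) = complex.Re x * complex.Im y + complex.Im x * complex.Re y.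
Proof. by case: x; case: y. Qed.

Lemma cmeasurableM f g : cmeasurable f -> cmeasurable g ->
  cmeasurable (fun x => f x * g x).
Proof.
move=> [f1 f2] [g1 g2]; split.
  under eq_fun do rewrite cReM.
  by apply: measurable_funB; exact: measurable_funM.
under eq_fun do rewrite cImM.
by apply: measurable_funD; exact: measurable_funM.
Qed.

Lemma cmeasurable_real (f : T -> R) : measurable_fun setT f ->
  cmeasurable (fun x => (f x)%:C).
Proof. by move=> mf; split=> //=; exact: measurable_cst. Qed.

Lemma cmeasurableX f n : cmeasurable f -> cmeasurable (fun x => f x ^+ n).
Proof.
move=> mf; elim: n => [|n IH].
  by under eq_fun do rewrite expr0; apply: cmeasurable_real; exact: measurable_cst.
by under eq_fun do rewrite exprS; exact: cmeasurableM.
Qed.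

Lemma cmeasurable_conj f : cmeasurable f -> cmeasurable (fun x => conjc (f x)).
Proof.
have ReJ (z : R[i]) : complex.Re (conjc z) = complex.Re z by case: z.
have ImJ (z : R[i]) : complex.Im (conjc z) = - complex.Im z by case: z.
move=> [f1 f2]; split; first by under eq_fun do rewrite ReJ.
by under eq_fun do rewrite ImJ; exact: measurableT_comp.
Qed.

(** Conjugation replaces inversion for negative exponents: it agrees with it on the unit circle and
    is visibly measurable. *)
Definition cpow (z : R[i]) (k : int) : R[i] :=
  match k with Posz n => z ^+ n | Negz n => conjc z ^+ n.+1 end.

Lemma cmeasurable_cpow f k : cmeasurable f -> cmeasurable (fun x => cpow (f x) k).
Proof.
by case: k => n mf; apply: cmeasurableX => //; exact: cmeasurable_conj.
Qed.

End ComplexMeasurability.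

Section Expi.
Variable R : realType.

Lemma expiD (x y : R) : expi (x + y) = expi x * expi y.
Proof.
apply/eqP; rewrite eq_complex cReM cImM /= cosD sinD.
by rewrite [sin x * _ + _]addrC !eqxx.
Qed.

Lemma expi_conj (x : R) : conjc (expi x) = expi (- x).
Proof. by rewrite /expi cosN sinN. Qed.

Lemma expiX (x : R) n : expi x ^+ n = expi (n%:R * x).
Proof.
elim: n => [|n IH]; first by rewrite mul0r /expi cos0 sin0.
by rewrite exprS IH -expiD -natr1 mulrDl mul1r addrC.
Qed.

Lemma cpow_expi (x : R) k : cpow (expi x) k = expi (k%:~R * x).
Proof.
case: k => n; rewrite /cpow; first by rewrite expiX.
by rewrite expi_conj expiX NegzE rmorphN/= mulNr mulrN.
Qed.

End Expi.

(** * Measurable functions of the matrix entries *)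

Section MeasurabilitySO3.
Variable R : realType.
Local Notation i0 := (ord0 : 'I_3).
Local Notation i1 := (lift ord0 ord0 : 'I_3).
Local Notation i2 := (lift ord0 (lift ord0 ord0) : 'I_3).

Lemma measurable_SO3_entry i j :
  measurable_fun [set: SO3 R] (fun A : SO3 R => val A i j).
Proof.
apply: (measurability _ (RGenOpens.measurableE R)).
move=> _ [_ [a [b ->] <-]]; rewrite setTI; apply: sub_sigma_algebra.
exists ((fun M : 'M[R]_3 => M i j) @^-1` `]a, b[) => //.
have /continuousP := @coord_continuous R 3 3 i j; apply.
exact: interval_open.
Qed.

(** Inversion coincides with the real power of exponent -1 on all of [0, +oo[, zero included, since
    both conventions give 0 there. *)
Lemma measurable_funV_ge0 d (T : measurableType d) (f : T -> R) :
  (forall x, 0 <= f x) -> measurable_fun setT f ->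
  measurable_fun setT (fun x => (f x)^-1).
Proof.
move=> f0 mf; under eq_fun do rewrite -powR_inv1//.
exact: (measurableT_comp (measurable_powR (- 1)) mf).
Qed.

Lemma measurable_fun_sqrt d (T : measurableType d) (f : T -> R) :
  measurable_fun setT f -> measurable_fun setT (fun x => Num.sqrt (f x)).
Proof.
apply: measurableT_comp; apply: continuous_measurable_fun.
exact: sqrt_continuous.
Qed.

Lemma measurable_wigner_d n k l : measurable_fun setT (wigner_d (R := R) n k l).
Proof.
rewrite /wigner_d; apply: measurable_funM; last exact: measurable_poly.
apply: measurable_funM.
  apply: measurable_funM; first exact: measurable_cst.
  apply: (measurableT_comp (measurable_powR _)).
  by apply: measurable_funM => //; exact: measurable_funB.
apply: (measurableT_comp (measurable_powR _)).
by apply: measurable_funM => //; exact: measurable_funD.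
Qed.

Lemma poly_bounded (p : {poly R}) :
  exists2 M, 0 <= M & forall x, -1 <= x <= 1 -> `|p.[x]| <= M.
Proof.
exists (\sum_(i < size p) `|p`_i|); first exact: sumr_ge0.
move=> x; rewrite -ler_norml => x1; rewrite horner_coef.
apply: le_trans (ler_norm_sum _ _ _) _; apply: ler_sum => i _.
by rewrite normrM normrX ler_piMr// exprn_ile1.
Qed.

(** Both half-angle powers are at most 1 on [-1, 1]. The bound later makes the beta integrand
    integrable for every k and l, as Fubini requires. *)
Lemma wigner_d_bounded n k l :
  exists2 M, 0 <= M & forall x, -1 <= x <= 1 -> `|wigner_d (R := R) n k l x| <= M.
Proof.
rewrite /wigner_d; set c := (-1) ^ _ * _ / _.
set a := _%:R / 2; set b := _%:R / 2; set p := jacobi _ _ _ _.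
have [M M0 pM] := poly_bounded p.
exists (`|c| * M)%R => [|x x1]; first exact: mulr_ge0.
have pow1 (y r : R) : 0 <= r -> 0 <= y <= 1 -> `|y `^ r| <= 1.
  move=> r0 /andP[y0 y1]; rewrite ger0_norm ?powR_ge0//.
  have -> : 1 = 1 `^ r by rewrite powR1.
  by rewrite ge0_ler_powR// nnegrE.
rewrite !normrM ler_pM ?mulr_ge0 ?pM// -[leRHS]mulr1 ler_pM ?mulr_ge0//.
  rewrite -[leRHS]mulr1 ler_pM// pow1 ?divr_ge0//; lra.
rewrite pow1 ?divr_ge0//; lra.
Qed.

Definition sin_beta (A : SO3 R) : R := Num.sqrt (1 - val A i2 i2 ^+ 2).

(* Unlike the angles themselves, exp(i alpha) and exp(i gamma) are explicit
   measurable functions of the entries (junk value 0 when sin beta = 0). *)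
Definition exp_alpha (A : SO3 R) : R[i] :=
  (val A i0 i2 +i* val A i1 i2) * ((sin_beta A)^-1)%:C.

Definition exp_gamma (A : SO3 R) : R[i] :=
  ((- val A i2 i0) +i* val A i2 i1) * ((sin_beta A)^-1)%:C.

Lemma measurable_sin_beta : measurable_fun setT sin_beta.
Proof.
apply: measurable_fun_sqrt; apply: measurable_funB; first exact: measurable_cst.
by apply: measurable_funX; exact: measurable_SO3_entry.
Qed.

Lemma cmeasurable_exp_alpha : cmeasurable exp_alpha.
Proof.
apply: cmeasurableM; first by split; exact: measurable_SO3_entry.
apply: cmeasurable_real; apply: measurable_funV_ge0 => [A|]; first exact: sqrtr_ge0.
exact: measurable_sin_beta.
Qed.

Lemma cmeasurable_exp_gamma : cmeasurable exp_gamma.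
Proof.
apply: cmeasurableM.
  split; last exact: measurable_SO3_entry.
  by apply: (measurableT_comp (@oppr_measurable R setT)); exact: measurable_SO3_entry.
apply: cmeasurable_real; apply: measurable_funV_ge0 => [A|]; first exact: sqrtr_ge0.
exact: measurable_sin_beta.
Qed.

Lemma sin_beta_euler a b c : 0 <= b <= pi -> sin_beta (euler a b c) = sin b.
Proof.
move=> bpi; rewrite /sin_beta; have [_ _ -> _ _] := euler_entries a b c.
by rewrite -sin2cos2 sqrtr_sqr ger0_norm// sin_ge0_pi.
Qed.

Lemma exp_alpha_euler a b c : 0 <= b <= pi -> sin b != 0 ->
  exp_alpha (euler a b c) = expi a.
Proof.
move=> bpi s0; rewrite /exp_alpha sin_beta_euler//.
have [-> -> _ _ _] := euler_entries a b c.
by apply/eqP; rewrite eq_complex/= !(mulr0, subr0, addr0, add0r) !mulfK// !eqxx.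
Qed.

Lemma exp_gamma_euler a b c : 0 <= b <= pi -> sin b != 0 ->
  exp_gamma (euler a b c) = expi c.
Proof.
move=> bpi s0; rewrite /exp_gamma sin_beta_euler//.
have [_ _ _ -> ->] := euler_entries a b c; rewrite opprK.
apply/eqP; rewrite eq_complex/= !(mulr0, subr0, addr0, add0r).
by rewrite !(mulrC (sin b)) !mulfK// !eqxx.
Qed.

End MeasurabilitySO3.

(** * The test function and its products with Wigner functions *)

Section TestFunction.
Variables (R : realType) (f : SO3 R -> R[i]).
Hypothesis hf : forall alpha beta gamma : R, 0 <= beta <= pi ->
  f (euler alpha beta gamma) =
    if (beta != 0) && (beta != pi) then ((Num.sqrt (sin beta))^-1)%:C else 0.
Local Notation i2 := (lift ord0 (lift ord0 ord0) : 'I_3).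

(** The convention 0^-1 = 0 reproduces the prescribed value 0 at the poles. Being free of angles,
    the formula also covers beta outside [0, pi], as met on the torus. *)
Lemma f_sin_beta A : f A = ((Num.sqrt (sin_beta A))^-1)%:C.
Proof.
have [[[a b] c] /= [bpi <-]] := euler_surj A.
rewrite hf// sin_beta_euler//; case: ifPn => //.
rewrite negb_and !negbK => /orP[] /eqP ->; by rewrite ?sin0 ?sinpi sqrtr0 invr0.
Qed.

Lemma cmeasurable_f : cmeasurable f.
Proof.
rewrite (_ : f = fun A => ((Num.sqrt (sin_beta A))^-1)%:C); last first.
  by apply/funext => A; exact: f_sin_beta.
apply: cmeasurable_real; apply: measurable_funV_ge0 => [A|].
  exact: sqrtr_ge0.
by apply: measurable_fun_sqrt; exact: measurable_sin_beta.
Qed.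

(** The product of [f] with the conjugate of [wigner_D], written through matrix entries; conjugation
    turns the exponents -k, -l into k, l. *)
Definition wigner_integrand n k l (A : SO3 R) : R[i] :=
  f A * ((Num.sqrt (2 * n + 1)%:R * wigner_d n k l (val A i2 i2))%:C *
   cpow (exp_alpha A) k * cpow (exp_gamma A) l).

Lemma cmeasurable_wigner_integrand n k l : cmeasurable (wigner_integrand n k l).
Proof.
apply: cmeasurableM; first exact: cmeasurable_f.
apply: cmeasurableM; last exact/cmeasurable_cpow/cmeasurable_exp_gamma.
apply: cmeasurableM; last exact/cmeasurable_cpow/cmeasurable_exp_alpha.
apply: cmeasurable_real; apply: measurable_funM; first exact: measurable_cst.
by apply: (measurableT_comp (measurable_wigner_d _ _ _)); exact: measurable_SO3_entry.
Qed.

Lemma wigner_integrand_euler n k l a b c : 0 <= b <= pi ->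
  wigner_integrand n k l (euler a b c) =
  ((Num.sqrt (sin b))^-1 * (Num.sqrt (2 * n + 1)%:R * wigner_d n k l (cos b)))%:C *
  expi (k%:~R * a + l%:~R * c).
Proof.
move=> bpi; rewrite /wigner_integrand f_sin_beta sin_beta_euler//.
(* At the poles the factor [f] is 0 and hides the junk values of [exp_alpha] and [exp_gamma]. *)
have [s0|s0] := eqVneq (sin b) 0; first by rewrite s0 sqrtr0 invr0 !mul0r.
rewrite exp_alpha_euler// exp_gamma_euler// !cpow_expi expiD.
have [_ _ -> _ _] := euler_entries a b c.
by rewrite [in RHS]rmorphM/= !mulrA.
Qed.

(** [euler_surj] guarantees that the chosen angles represent [A]; the right side depends on [A]
    alone, so the choice does not matter. *)
Lemma mulf_wigner_D n k l A : f A * (wigner_D n k l A)^* = wigner_integrand n k l A.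
Proof.
rewrite /wigner_D; have := @xgetPex _ (0, 0, 0) _ (euler_surj A).
rewrite -/(euler_angles A); case: (euler_angles A) => [[a b] c] /= [bpi <-].
rewrite wigner_integrand_euler// f_sin_beta sin_beta_euler//.
have conjE (z : R[i]) : Num.conj z = conjc z by [].
have conjR (x : R) : conjc x%:C = x%:C by rewrite /conjc/= oppr0.
move: (wigner_d n k l (cos b)) => w; rewrite !rmorphM/= !conjE !expi_conj !opprK expiD !conjR.
by rewrite -!mulrA; congr (_ * (_ * _)); rewrite mulrCA.
Qed.

End TestFunction.

Import HBNNSimple.

(** * Integration against the pushforward of a weighted measure *)

Section ChangeOfVariables.
Context d1 d2 (X : measurableType d1) (Y : measurableType d2) (R : realType).
Variables (mu : {measure set X -> \bar R}) (nu : {measure set Y -> \bar R}).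
Variables (D : set X) (phi : X -> Y) (w : X -> R).
Hypotheses (mD : measurable D) (mphi : measurable_fun setT phi).
Hypotheses (mw : measurable_fun setT w) (w0 : forall x, D x -> 0 <= w x).
Hypothesis nuE : forall A, measurable A ->
  nu A = (\int[mu]_(x in D `&` phi @^-1` A) (w x)%:E)%E.
Local Open Scope ereal_scope.

(** [nuE] is the claim for indicators; linearity extends it to simple functions and monotone
    convergence to all of them. It serves [haar] with the sine density and [circle_measure] with
    weight 1. *)
Lemma ge0_integral_weighted_pushforward (G : Y -> \bar R) :
  measurable_fun setT G -> (forall y, 0 <= G y) ->
  \int[nu]_y G y = \int[mu]_(x in D) (G (phi x) * (w x)%:E).
Proof.
move=> mG G0; pose g := nnsfun_approx measurableT mG.
have mgphi n : measurable_fun setT (fun x => g n (phi x)).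
  by apply: (measurableT_comp _ mphi); exact: measurable_funP.
have mpre (A : set Y) : measurable A -> measurable (phi @^-1` A).
  by move=> mA; rewrite -[X in measurable X]setTI; exact: mphi.
have -> : \int[nu]_y G y = limn (fun n => \int[nu]_y (g n y)%:E).
  rewrite -monotone_convergence//.
  - apply: eq_integral => y _; apply/esym/cvg_lim => //.
    exact: cvg_nnsfun_approx.
  - by move=> n; exact/measurable_EFinP/measurable_funP.
  - by move=> n y _; rewrite lee_fin.
  - by move=> y _ m n mn; rewrite lee_fin; exact/lefP/nd_nnsfun_approx.
have -> : \int[mu]_(x in D) (G (phi x) * (w x)%:E) =
    limn (fun n => \int[mu]_(x in D) ((g n (phi x))%:E * (w x)%:E)).
  rewrite -monotone_convergence//.
  - apply: eq_integral => x _; apply/esym/cvg_lim => //.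
    by apply: cvgeZr => //; exact: cvg_nnsfun_approx.
  - move=> n; apply: measurable_funTS; apply: emeasurable_funM; exact/measurable_EFinP.
  - by move=> n x Dx; rewrite mule_ge0// lee_fin ?w0.
  - move=> x Dx m n mn; rewrite lee_wpmul2r ?lee_fin ?w0//.
    exact/lefP/nd_nnsfun_approx.
congr (limn _); apply/funext => n.
rewrite integralT_nnsfun sintegralE.
under [RHS]eq_integral => x _.
  rewrite fimfunE -fsumEFin// ge0_mule_fsuml; last first.
    by move=> r; exact: nnfun_muleindic_ge0.
  over.
rewrite ge0_integral_fsum//.
- apply: eq_fsbigr => r; rewrite inE => -[y _ <-].
  set r0 := g n y; have mS : measurable (g n @^-1` [set r0]) by exact: measurable_sfunP.
  under [RHS]eq_integral do rewrite EFinM -muleA.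
  rewrite ge0_integralZl//; last 3 first.
  + apply: measurable_funTS; apply: emeasurable_funM; last exact/measurable_EFinP.
    by apply/measurable_EFinP; apply: (measurableT_comp _ mphi).
  + by move=> x Dx; rewrite mule_ge0 ?lee_fin ?w0.
  + by rewrite lee_fin.
  congr (_ * _); rewrite nuE// integral_mkcondr; apply: eq_integral => x _.
  by rewrite muleC epatch_indic.
- move=> r; apply: measurable_funTS; apply: emeasurable_funM; last exact/measurable_EFinP.
  apply/measurable_EFinP; apply: measurable_funM => //.
  apply: (measurableT_comp _ mphi).
  by apply: measurable_indic; exact: measurable_sfunP.
- by move=> r x Dx; rewrite mule_ge0 ?lee_fin ?w0//; exact: nnfun_muleindic_ge0.
Qed.

Lemma integral_weighted_pushforward (G : Y -> R) : measurable_fun setT G ->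
  \int[nu]_y (G y)%:E = \int[mu]_(x in D) (G (phi x) * w x)%:E.
Proof.
move=> /measurable_EFinP mG; rewrite integralE [RHS]integralE.
rewrite !ge0_integral_weighted_pushforward//; last 2 first.
- exact: measurable_funeneg.
- exact: measurable_funepos.
(* Multiplying by w >= 0 commutes with taking positive and negative parts. *)
congr (_ - _); apply: eq_integral => x /set_mem Dx.
  by rewrite !funeposE -!EFin_max -EFinM maxr_pMl ?w0// mul0r.
by rewrite !funenegE -!EFinN -!EFin_max -EFinM maxr_pMl ?w0// mul0r mulNr.
Qed.

End ChangeOfVariables.

Section Haar.
Variable R : realType.
Local Open Scope ereal_scope.

Lemma haar_density_ge0 (t : measurableTypeR R * measurableTypeR R * measurableTypeR R) :
  euler_box t -> (0 <= haar_density t)%R.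
Proof.
move=> [[_ /=]]; rewrite in_itv/= => bpi _.
by rewrite divr_ge0 ?sin_ge0_pi// mulr_ge0// sqr_ge0.
Qed.

Lemma measurable_haar_density : measurable_fun setT (@haar_density R).
Proof.
apply: measurable_funM => //; apply: (@measurableT_comp _ _ _ _ _ _ (@sin R)).
  by apply: continuous_measurable_fun; exact: continuous_sin.
exact: (measurableT_comp measurable_snd measurable_fst).
Qed.

Lemma ge0_integral_haar (G : SO3 R -> \bar R) :
  measurable_fun setT G -> (forall A, 0 <= G A) ->
  \int[@haar R]_A G A =
  \int[@lebesgue3 R]_(t in @euler_box R) (G (euler3 t) * (haar_density t)%:E).
Proof.
apply: ge0_integral_weighted_pushforward => //.
- exact: measurable_euler_box.
- exact: measurable_euler3.
- exact: measurable_haar_density.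
- exact: haar_density_ge0.
Qed.

Lemma integral_haar (G : SO3 R -> R) : measurable_fun setT G ->
  \int[@haar R]_A (G A)%:E =
  \int[@lebesgue3 R]_(t in @euler_box R) (G (euler3 t) * haar_density t)%:E.
Proof.
apply: integral_weighted_pushforward => //.
- exact: measurable_euler_box.
- exact: measurable_euler3.
- exact: measurable_haar_density.
- exact: haar_density_ge0.
Qed.

End Haar.

(** * Fubini for products of functions of separate variables *)

Section ProductIntegral.
Context d1 d2 (X : measurableType d1) (Y : measurableType d2) (R : realType).
Variables (mu : {sigma_finite_measure set X -> \bar R}).
Variables (nu : {sigma_finite_measure set Y -> \bar R}).
Local Open Scope ereal_scope.

Lemma integrable_prodM (A : set X) (B : set Y) (f : X -> R) (g : Y -> R) :
  measurable A -> measurable B ->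
  mu.-integrable A (EFin \o f) -> nu.-integrable B (EFin \o g) ->
  (mu \x nu).-integrable (A `*` B) (fun z => (f z.1 * g z.2)%:E) /\
  \int[mu \x nu]_(z in A `*` B) (f z.1 * g z.2)%:E =
  (\int[mu]_(x in A) (f x)%:E) * (\int[nu]_(y in B) (g y)%:E).
Proof.
move=> mA mB intf intg.
(* Extension by zero moves the problem from the rectangle to the whole product space. *)
pose f' := f \_ A; pose g' := g \_ B.
have intf' : mu.-integrable setT (EFin \o f').
  by rewrite -restrict_EFin; apply/integrable_restrict => //; rewrite setTI.
have intg' : nu.-integrable setT (EFin \o g').
  by rewrite -restrict_EFin; apply/integrable_restrict => //; rewrite setTI.
have mf' : measurable_fun setT f' by apply/measurable_EFinP/(measurable_int mu).
have mg' : measurable_fun setT g' by apply/measurable_EFinP/(measurable_int nu).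
have restrictE : (fun z => (f z.1 * g z.2)%:E) \_ (A `*` B) =
    (fun z => (f' z.1 * g' z.2)%:E).
  apply/funext => -[x y]; rewrite /f' /g' /patch/= in_setX.
  by case: (x \in A); case: (y \in B); rewrite /= ?mulr0 ?mul0r.
have mfg : measurable_fun setT (fun z : X * Y => (f' z.1 * g' z.2)%:E).
  apply/measurable_EFinP; apply: measurable_funM.
    exact: (measurableT_comp mf' measurable_fst).
  exact: (measurableT_comp mg' measurable_snd).
have int : (mu \x nu).-integrable setT (fun z => (f' z.1 * g' z.2)%:E).
  apply/integrable12ltyP => //.
  under eq_integral => x _.
    under eq_integral => y _ do rewrite /= normrM EFinM.
    rewrite ge0_integralZl//; last by do 2 apply: measurableT_comp => //.
    over.
  have := intg' => /integrableP[_]; rewrite /= => Ig.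
  have := intf' => /integrableP[_]; rewrite /= => If.
  rewrite ge0_integralZr//=.
    by rewrite lte_mul_pinfty// ?integral_ge0// ge0_fin_numE// integral_ge0.
    by do 2 apply: measurableT_comp => //.
  exact: integral_ge0.
split.
  by apply/integrable_mkcond; rewrite ?restrictE//; exact: measurableX.
rewrite integral_mkcond restrictE -integral12_prod_meas1//.
transitivity (\int[mu]_x ((f' x)%:E * \int[nu]_y (g' y)%:E)).
  apply: eq_integral => x _; rewrite /fubini_F/= -integralZl//.
transitivity ((\int[mu]_x (f' x)%:E) * \int[nu]_y (g' y)%:E).
  rewrite -(fineK (integrable_fin_num measurableT intg'))/=.
  by rewrite integralZr.
by congr (_ * _); rewrite [RHS]integral_mkcond restrict_EFin.
Qed.

End ProductIntegral.

Section SigmaFiniteProduct.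
Context d1 d2 (X : measurableType d1) (Y : measurableType d2) (R : realType).
Variables (mu : {sigma_finite_measure set X -> \bar R}).
Variables (nu : {sigma_finite_measure set Y -> \bar R}).

Let sigma_finite_prod : sigma_finite setT (mu \x nu)%E.
Proof.
by case: (lebesgue_integral_fubini.measure_function_Measure_isSigmaFinite__to__measure_function_isSigmaFinite
  mu nu).
Qed.

(* The library only registers a sigma-finite structure on products of
   sub-probabilities. *)
Definition sigma_finite_prod_measure := (mu \x nu)%E.
HB.instance Definition _ := Measure.on sigma_finite_prod_measure.
HB.instance Definition _ := Measure_isSigmaFinite.Build _ _ _
  sigma_finite_prod_measure sigma_finite_prod.

End SigmaFiniteProduct.

Section ProductIntegral3.
Context d1 d2 d3 (X : measurableType d1) (Y : measurableType d2)
  (Z : measurableType d3) (R : realType).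
Variables (mu : {sigma_finite_measure set X -> \bar R}).
Variables (nu : {sigma_finite_measure set Y -> \bar R}).
Variables (rho : {sigma_finite_measure set Z -> \bar R}).
Local Open Scope ereal_scope.

Lemma integrable_prodM3 (A : set X) (B : set Y) (C : set Z)
    (f : X -> R) (g : Y -> R) (h : Z -> R) :
  measurable A -> measurable B -> measurable C ->
  mu.-integrable A (EFin \o f) -> nu.-integrable B (EFin \o g) ->
  rho.-integrable C (EFin \o h) ->
  (mu \x nu \x rho).-integrable (A `*` B `*` C)
    (fun t => (f t.1.1 * g t.1.2 * h t.2)%:E) /\
  \int[mu \x nu \x rho]_(t in A `*` B `*` C) (f t.1.1 * g t.1.2 * h t.2)%:E =
  (\int[mu]_(x in A) (f x)%:E) * (\int[nu]_(y in B) (g y)%:E) *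
  (\int[rho]_(z in C) (h z)%:E).
Proof.
move=> mA mB mC intf intg inth.
have [ifg <-] := integrable_prodM mA mB intf intg.
have mAB := measurableX mA mB.
exact: (@integrable_prodM _ _ _ Z R (sigma_finite_prod_measure mu nu) rho _ _
  (fun z => (f z.1 * g z.2)%R) h mAB mC ifg inth).
Qed.

End ProductIntegral3.

(** * Integrals of sines and cosines over a period *)

Section TrigonometricIntegrals.
Variable R : realType.
Local Notation mu := (@lebesgue_measure R).
Implicit Types k : int.

Definition period : set R := `[0, pi *+ 2[.

Lemma integrable_period (g : R -> R) : continuous g -> mu.-integrable period (EFin \o g).
Proof.
move=> cg; apply: (@integrableS _ _ _ mu `[0, pi *+ 2]) => //.
- exact: measurable_itv.
- by move=> x; exact: subset_itv_co_cc.
apply: continuous_compact_integrable; first exact: segment_compact.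
exact: continuous_subspaceT.
Qed.

Lemma expi_2pi k : expi (k%:~R * (pi *+ 2)) = 1 :> R[i].
Proof.
rewrite -cpow_expi.
have -> : expi (pi *+ 2) = 1 :> R[i].
  by rewrite /expi -[pi *+ 2]add0r cosD2pi sinD2pi cos0 sin0.
by case: k => n; rewrite /cpow ?conjc1 expr1n.
Qed.

Lemma continuous_cosZ k : continuous (fun x : R => cos (k%:~R * x)).
Proof.
move=> x; apply: (@continuous_comp _ _ _ (fun x : R => k%:~R * x) (@cos R)).
  exact: mulrl_continuous.
exact: continuous_cos.
Qed.

Lemma continuous_sinZ k : continuous (fun x : R => sin (k%:~R * x)).
Proof.
move=> x; apply: (@continuous_comp _ _ _ (fun x : R => k%:~R * x) (@sin R)).
  exact: mulrl_continuous.
exact: continuous_sin.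
Qed.

Lemma integral_period_deriv (g G : R -> R) : continuous g ->
  (forall x : R, is_derive x 1 G (g x)) ->
  (\int[mu]_(x in period) (g x)%:E = (G (pi *+ 2) - G 0)%:E)%E.
Proof.
move=> cg dG; have cG : continuous G.
  by move=> x; apply/differentiable_continuous/derivable1_diffP; case: (dG x).
rewrite integral_itv_bndo_bndc; last first.
  by apply/measurable_EFinP/measurable_funTS; exact: continuous_measurable_fun.
rewrite (@continuous_FTC2 _ _ G)//.
- by rewrite mulrn_wgt0// pi_gt0.
- exact: continuous_subspaceT.
- split=> [x _| |]; first by case: (dG x).
  + by apply: cvg_at_right_filter; exact: cG.
  + by apply: cvg_at_left_filter; exact: cG.
- by move=> x _; have h := dG x; rewrite derive1E derive_val.
Qed.

Lemma integral_cos_period k :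
  (\int[mu]_(x in period) (cos (k%:~R * x))%:E = (if k == 0 then pi *+ 2 else 0)%:E)%E.
Proof.
have [->|k0] := eqVneq k 0.
  under eq_integral do rewrite mul0r cos0.
  rewrite (@integral_period_deriv (cst 1) id) ?subr0//; first exact: cst_continuous.
have kR : k%:~R != 0 :> R by rewrite intr_eq0.
have dG (x : R) : is_derive x 1 (fun x => k%:~R^-1 * sin (k%:~R * x)) (cos (k%:~R * x)).
  have d1 : is_derive x 1 (fun x : R => k%:~R * x) (k%:~R : R).
    by apply: is_derive_eq; rewrite scaler1.
  have d2 := is_derive1_comp (is_derive_sin (k%:~R * x)) d1.
  apply: is_derive_eq.
  by rewrite /GRing.scale/= mulrCA mulVf// mulr1.
rewrite (integral_period_deriv (@continuous_cosZ k) dG).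
(* Destructing the complex equation yields its real and imaginary parts, cos(2 pi k) = 1 and sin(2
   pi k) = 0. *)
by have [_ ->] := expi_2pi k; rewrite !mulr0 sin0 mulr0 subrr.
Qed.

Lemma integral_sin_period k :
  (\int[mu]_(x in period) (sin (k%:~R * x))%:E = 0)%E.
Proof.
have [->|k0] := eqVneq k 0.
  by rewrite integral0_eq// => x _; rewrite mul0r sin0.
have kR : k%:~R != 0 :> R by rewrite intr_eq0.
have dG (x : R) : is_derive x 1 (fun x => - k%:~R^-1 * cos (k%:~R * x)) (sin (k%:~R * x)).
  have d1 : is_derive x 1 (fun x : R => k%:~R * x) (k%:~R : R).
    by apply: is_derive_eq; rewrite scaler1.
  have d2 := is_derive1_comp (is_derive_cos (k%:~R * x)) d1.
  apply: is_derive_eq.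
  by rewrite /GRing.scale/= mulNr mulNr mulrN opprK mulrCA mulVf// mulr1.
rewrite (integral_period_deriv (@continuous_sinZ k) dG).
by have [-> _] := expi_2pi k; rewrite mulr0 cos0 subrr.
Qed.

End TrigonometricIntegrals.

(** * Harmonic coefficients of the test function *)

Section HarmonicCoefficients.
Variables (R : realType) (f : SO3 R -> R[i]).
Hypothesis hf : forall alpha beta gamma : R, 0 <= beta <= pi ->
  f (euler alpha beta gamma) =
    if (beta != 0) && (beta != pi) then ((Num.sqrt (sin beta))^-1)%:C else 0.
Local Notation mR := (measurableTypeR R).
Local Notation mu := (@lebesgue_measure R).

Lemma integral_euler_box_prod (g h p : R -> R) :
  mu.-integrable (@period R) (EFin \o g) ->
  mu.-integrable `[0, pi] (EFin \o h) ->
  mu.-integrable (@period R) (EFin \o p) ->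
  (@lebesgue3 R).-integrable (@euler_box R)
    (fun t => (g t.1.1 * h t.1.2 * p t.2)%:E) /\
  (\int[@lebesgue3 R]_(t in @euler_box R) (g t.1.1 * h t.1.2 * p t.2)%:E =
   (\int[mu]_(x in @period R) (g x)%:E) * (\int[mu]_(x in `[0%R, pi]) (h x)%:E) *
   (\int[mu]_(x in @period R) (p x)%:E))%E.
Proof.
move=> ig ih ip.
have mper : measurable (@period R : set mR) by exact: measurable_itv.
have mpi : measurable (`[0, pi] : set mR) by exact: measurable_itv.
exact: (@integrable_prodM3 _ _ _ mR mR mR R mu mu mu _ _ _ g h p mper mpi mper).
Qed.

Definition polar_factor n k l (b : R) : R :=
  Num.sqrt (2 * n + 1)%:R / (8 * pi ^+ 2) *
  (Num.sqrt (sin b) * wigner_d n k l (cos b)).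

Lemma integrable_polar_factor n k l :
  mu.-integrable `[0, pi] (EFin \o polar_factor n k l).
Proof.
have [M M0 dM] := @wigner_d_bounded R n k l.
set c := Num.sqrt (2 * n + 1)%:R / (8 * pi ^+ 2) : R.
apply: (@le_integrable _ _ _ mu _ _ _ (EFin \o cst (`|c| * M))).
- exact: measurable_itv.
- apply/measurable_EFinP/measurable_funTS; apply: measurable_funM => //.
  apply: measurable_funM.
    apply: measurable_fun_sqrt; apply: continuous_measurable_fun.
    exact: continuous_sin.
  apply: measurableT_comp; first exact: measurable_wigner_d.
  by apply: continuous_measurable_fun; exact: continuous_cos.
- move=> b _ /=; rewrite lee_fin /polar_factor -/c normrM [leRHS]ger0_norm ?mulr_ge0//.
  rewrite ler_wpM2l// normrM -[leRHS]mul1r ler_pM//.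
    by rewrite ger0_norm ?sqrtr_ge0// -[leRHS]sqrtr1 ler_sqrt// sin_le1.
  by apply: dM; rewrite cos_geN1 cos_le1.
- apply: continuous_compact_integrable; first exact: segment_compact.
  by apply: continuous_subspaceT; exact: cst_continuous.
Qed.

(** [cintegral] treats real and imaginary parts separately, so the addition formulas split exp(i(k
    alpha + l gamma)) into four real products. Those with a sine integrate to 0, and a cosine
    survives only at frequency 0. *)
Lemma harmonic_coefE n k l : harmonic_coef f n k l =
  ((if k == 0 then pi *+ 2 else 0) *
   (\int[mu]_(b in `[0, pi]) polar_factor n k l b) *
   (if l == 0 then pi *+ 2 else 0))%:C.
Proof.
have [m1 m2] := cmeasurable_wigner_integrand hf n k l.
have E : (fun A => f A * (wigner_D n k l A)^*) = wigner_integrand f n k l.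
  by apply/funext => A; exact: (mulf_wigner_D hf).
have dens (t : mR * mR * mR) : euler_box t ->
    wigner_integrand f n k l (euler3 t) * (haar_density t)%:C =
    (polar_factor n k l t.1.2)%:C * expi (k%:~R * t.1.1 + l%:~R * t.2).
  move=> tbox; have bpi : 0 <= t.1.2 <= pi by case: tbox => [[_ /=]]; rewrite in_itv.
  rewrite /euler3 (wigner_integrand_euler hf)// mulrAC -rmorphM/=; congr (_%:C * _).
  have s0 := sin_ge0_pi bpi; rewrite /haar_density /polar_factor.
  rewrite -{2}(sqr_sqrtr s0).
  (* At the poles r^-1 r^2 = r still holds, as 0 = 0. *)
  have [->|r0] := eqVneq (Num.sqrt (sin t.1.2)) 0.
    by rewrite invr0 !(mul0r, mulr0).
  have p0 : pi != 0 :> R by rewrite gt_eqF ?pi_gt0.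
  by move: (Num.sqrt (sin t.1.2)) r0 (pi : R) p0 => r r0 p p0; field; rewrite r0 p0.
have Ic j := integrable_period (@continuous_cosZ R j).
have Is j := integrable_period (@continuous_sinZ R j).
have Ip := integrable_polar_factor n k l.
have [i1 e1] := integral_euler_box_prod (Ic k) Ip (Ic l).
have [i2 e2] := integral_euler_box_prod (Is k) Ip (Is l).
have [i3 e3] := integral_euler_box_prod (Is k) Ip (Ic l).
have [i4 e4] := integral_euler_box_prod (Ic k) Ip (Is l).
have fB : (\int[mu]_(b in `[0%R, pi]) (polar_factor n k l b)%:E)%E \is a fin_num.
  by apply: integrable_fin_num Ip; exact: measurable_itv.
rewrite /harmonic_coef /L2_inner E /cintegral /Rintegral !integral_haar//.
congr (_ +i* _).
  transitivity (fine (\int[@lebesgue3 R]_(t in @euler_box R)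
     ((cos (k%:~R * t.1.1) * polar_factor n k l t.1.2 * cos (l%:~R * t.2))%:E -
      (sin (k%:~R * t.1.1) * polar_factor n k l t.1.2 * sin (l%:~R * t.2))%:E)))%E.
    congr fine; apply: eq_integral => t /set_mem /dens /(congr1 (@complex.Re R)).
    rewrite !cReM /= mulr0 subr0 => ->; rewrite mul0r subr0 cosD -EFinB.
    by congr EFin; ring.
  rewrite integralB_EFin//; last exact: measurable_euler_box.
  rewrite e1 e2 !integral_cos_period !integral_sin_period !mul0e sube0.
  by rewrite -(fineK fB) -!EFinM.
transitivity (fine (\int[@lebesgue3 R]_(t in @euler_box R)
   ((sin (k%:~R * t.1.1) * polar_factor n k l t.1.2 * cos (l%:~R * t.2))%:E +
    (cos (k%:~R * t.1.1) * polar_factor n k l t.1.2 * sin (l%:~R * t.2))%:E)))%E.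
  congr fine; apply: eq_integral => t /set_mem /dens /(congr1 (@complex.Im R)).
  rewrite !cImM /= mulr0 add0r => ->; rewrite mul0r addr0 sinD -EFinD.
  by congr EFin; ring.
rewrite integralD_EFin//; last exact: measurable_euler_box.
by rewrite e3 e4 !integral_cos_period !integral_sin_period !mul0e mule0 adde0.
Qed.

End HarmonicCoefficients.

(** * Membership in the Sobolev space *)

Section Sobolev.
Variables (R : realType) (f : SO3 R -> R[i]).
Hypothesis hf : forall alpha beta gamma : R, 0 <= beta <= pi ->
  f (euler alpha beta gamma) =
    if (beta != 0) && (beta != pi) then ((Num.sqrt (sin beta))^-1)%:C else 0.
Local Notation mR := (measurableTypeR R).
Local Notation mu := (@lebesgue_measure R).

Lemma normc_real2 (x : R) : Normc.normc x%:C ^+ 2 = x ^+ 2.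
Proof. by rewrite /= expr0n/= addr0 sqrtr_sqr real_normK ?num_real. Qed.

(** In Euler angles, |f|^2 times the Haar density is 1/(8 pi^2) where sin beta is nonzero and 0
    elsewhere, hence dominated by a constant on the bounded box. *)
Lemma L2_f : L2 (@haar R) f.
Proof.
split; first exact: cmeasurable_f hf.
have fE A : Normc.normc (f A) ^+ 2 = ((Num.sqrt (sin_beta A))^-1) ^+ 2.
  by rewrite (f_sin_beta hf) normc_real2.
under eq_integral do rewrite fE.
rewrite ge0_integral_haar; last 2 first.
- apply/measurable_EFinP; apply: measurable_funX.
  apply: measurable_funV_ge0 => [A|]; first exact: sqrtr_ge0.
  by apply: measurable_fun_sqrt; exact: measurable_sin_beta.
- by move=> A; rewrite lee_fin sqr_ge0.
have ic := integrable_period (@cst_continuous R R 1).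
have ih : mu.-integrable `[0, pi] (EFin \o cst (8 * pi ^+ 2)^-1).
  apply: continuous_compact_integrable; first exact: segment_compact.
  by apply: continuous_subspaceT; exact: cst_continuous.
have [i _] := integral_euler_box_prod ic ih ic.
have mB := @measurable_euler_box R.
apply: le_lt_trans (integrable_lty mB i).
apply: ge0_le_integral => //.
- move=> t tbox; rewrite mule_ge0// lee_fin ?sqr_ge0//; exact: haar_density_ge0.
- apply: measurable_funTS; apply: emeasurable_funM; apply/measurable_EFinP.
    apply: measurable_funX; apply: measurable_funV_ge0 => [A|]; first exact: sqrtr_ge0.
    apply: measurable_fun_sqrt; apply: (measurableT_comp (@measurable_sin_beta R)).
    exact: measurable_euler3.
  exact: measurable_haar_density.
- exact: measurable_int i.
- move=> t tbox; rewrite -EFinM lee_fin mul1r mulr1 /euler3 sin_beta_euler.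
    have bpi : 0 <= t.1.2 <= pi by case: tbox => [[_ /=]]; rewrite in_itv.
    have s0 := sin_ge0_pi bpi; rewrite /haar_density exprVn sqr_sqrtr// mulrA.
    have p8 : 0 <= (8 * pi ^+ 2)^-1 :> R by rewrite invr_ge0 mulr_ge0// sqr_ge0.
    rewrite ler_piMl//.
    have [->|s1] := eqVneq (sin t.1.2) 0; first by rewrite mulr0.
    by rewrite mulVf.
  by case: tbox => [[_ /=]]; rewrite in_itv.
Qed.

Lemma wigner_d00 n x : wigner_d n 0 0 x = (jacobi R 0 0 n).[x].
Proof.
rewrite /wigner_d /= !subn0 !addn0 bin0.
rewrite (_ : (2 * n - n)%N = n); last by rewrite mul2n -addnn addnK.
by rewrite binn sqrtr1 invr1 mul0r !powRr0 expr0z !mul1r.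
Qed.

(** The factor 1/2 is (2 pi)^2 / (8 pi^2): two full periods against the Haar normalization. *)
Lemma harmonic_coef00 n :
  harmonic_coef f n 0 0 = (Num.sqrt (2 * n + 1)%:R / 2 * legendre_moment R n)%:C.
Proof.
rewrite (harmonic_coefE hf) eqxx; congr (_%:C).
have -> : \int[mu]_(b in `[0, pi]) polar_factor n 0 0 b =
    Num.sqrt (2 * n + 1)%:R / (8 * pi ^+ 2) * legendre_moment R n.
  rewrite -RintegralZl//; last exact: integrable_sqrt_sin_horner.
  by apply: eq_Rintegral => b _; rewrite /polar_factor wigner_d00.
have p0 : pi != 0 :> R by rewrite gt_eqF ?pi_gt0.
by rewrite -mulr_natr; move: (pi : R) p0 => p p0; field.
Qed.

Lemma sobolev_f (s : R) : 0 <= s < 2^-1 -> sobolev s f.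
Proof.
move=> s01; split; first exact: L2_f.
apply: le_lt_trans (legendre_series s01); rewrite le_eqVlt; apply/orP; left; apply/eqP.
apply: eq_eseriesr => n _; congr EFin.
have nN : (n < (2 * n).+1)%N by rewrite ltnS mul2n -addnn leq_addr.
(* Indices are shifted by n, so position n of the double sum encodes frequency 0. *)
pose N := Ordinal nN.
have i0 (i : 'I_(2 * n).+1) : i != N -> (i%:Z - n%:Z == 0) = false.
  by apply: contraNF; rewrite subr_eq0 => /eqP[] iN; apply/eqP/val_inj.
rewrite (bigD1 N isT) [X in _ + X = _]big1 ?addr0; last first.
  move=> i; rewrite andTb => iN; apply: big1 => j _; rewrite (harmonic_coefE hf) i0// !mul0r.
  by rewrite normc_real2 expr0n/= mulr0.
rewrite (bigD1 N isT) [X in _ + X = _]big1 ?addr0; last first.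
  move=> j; rewrite andTb => jN; rewrite (harmonic_coefE hf) (i0 j)// mulr0.
  by rewrite normc_real2 expr0n/= mulr0.
by rewrite subrr harmonic_coef00 normc_real2.
Qed.

End Sobolev.

(** * Divergence of the integral of 1 / sin *)

Section InverseSine.
Variable R : realType.
Local Notation mu := (@lebesgue_measure R).

Lemma measurable_inv_sin : measurable_fun (`]0, pi[ : set R) (fun x => (sin x)^-1).
Proof.
apply: open_continuous_measurable_fun; first exact: interval_open.
move=> x; rewrite inE/= in_itv/= => /sin_gt0_pi s0.
by apply: continuousV; [rewrite gt_eqF|exact: continuous_sin].
Qed.

(* Since cos <= 1, the function 1 / sin dominates the derivative of ln sin. *)
Lemma integral_inv_sin_ge (M : R) : 0 < M ->
  (M%:E <= \int[mu]_(x in `]0%R, pi[) ((sin x)^-1)%:E)%E.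
Proof.
(* Chosen so that with e = asin y the primitive ln sin grows by exactly M from e to pi/2. *)
move=> M0; pose y := expR (- M).
have y0 : 0 < y by exact: expR_gt0.
have y1 : y < 1 by rewrite expR_lt1 oppr_lt0.
have y11 : -1 <= y < 1 by rewrite y1 andbT; lra.
have y11' : y \in `[-1, 1] by rewrite in_itv/= !ltW//; lra.
pose e := asin y; have se : sin e = y by rewrite asinK.
have epi : e < pi / 2 by exact: asin_ltpi2.
have e0 : 0 < e.
  rewrite ltNge; apply/negP => e0.
  have : sin (- e) >= 0.
    apply: sin_ge0_pi; rewrite oppr_ge0 e0/=.
    have := @asin_geNpi2 R y; rewrite -/e => /(_ ltac:(lra)).
    by have := pi_gt0 R; lra.
  by rewrite sinN se; lra.
have pi0 := pi_gt0 R.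
have sub : `[e, pi / 2] `<=` (`]0, pi[ : set R).
  by move=> x /=; rewrite !in_itv/=; lra.
have s0 (x : R) : x \in `[e, pi / 2] -> 0 < sin x.
  by move=> /sub /=; rewrite in_itv/=; exact: sin_gt0_pi.
have dln (x : R) : 0 < sin x -> is_derive x 1 (@ln R \o sin) ((sin x)^-1 * cos x).
  by move=> sx; exact: (is_derive1_comp (is_derive1_ln sx) (is_derive_sin x)).
have cln (x : R) : 0 < sin x -> {for x, continuous (@ln R \o sin)}.
  move=> sx; apply/differentiable_continuous/derivable1_diffP.
  by case: (dln x sx).
have sin_pos (x : R) : x \in `]0, pi[ -> (0 <= ((sin x)^-1)%:E)%E.
  by rewrite in_itv/= lee_fin invr_ge0 => /sin_gt0_pi /ltW.
have ccs : {within `[e, pi / 2], continuous (fun x => (sin x)^-1 * cos x)}.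
  apply: continuous_in_subspaceT => x /set_mem xe; apply: cvgM.
    by apply: cvgV; [rewrite gt_eqF// s0|exact: continuous_sin].
  exact: continuous_cos.
apply: (@le_trans _ _ (\int[mu]_(x in `[e, (pi / 2)%R]) ((sin x)^-1)%:E)%E); last first.
  apply: ge0_subset_integral; [exact: measurable_itv|exact: measurable_itv|..] => //.
  by apply/measurable_EFinP; exact: measurable_inv_sin.
have -> : M%:E = (\int[mu]_(x in `[e, (pi / 2)%R]) ((sin x)^-1 * cos x)%:E)%E.
  rewrite (@continuous_FTC2 _ _ (@ln R \o sin))//.
  - by rewrite /= sin_pihalf ln1 se expRK -EFinB sub0r opprK.
  - split=> [x xe| |].
    + have /s0/dln[]// : x \in `[e, pi / 2] by move: xe; rewrite !in_itv/=; lra.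
    + by apply: cvg_at_right_filter; apply: cln; rewrite s0// in_itv/=; lra.
    + by apply: cvg_at_left_filter; apply: cln; rewrite s0// in_itv/=; lra.
  - move=> x xe.
    have /s0/dln h : x \in `[e, pi / 2] by move: xe; rewrite !in_itv/=; lra.
    by rewrite derive1E derive_val.
apply: ge0_le_integral.
- exact: measurable_itv.
- move=> x xe; rewrite lee_fin mulr_ge0 ?invr_ge0 ?(ltW (s0 _ xe))//.
  by apply: cos_ge0_pihalf; move: xe; rewrite /= in_itv/=; lra.
- apply/measurable_EFinP; apply: subspace_continuous_measurable_fun => //.
- by apply/measurable_EFinP; apply: measurable_funS sub measurable_inv_sin.
- move=> x xe; rewrite lee_fin ler_piMr ?cos_le1// invr_ge0 ltW// s0//.
Qed.

Lemma integral_inv_sin : (\int[mu]_(x in `]0%R, pi[) ((sin x)^-1)%:E = +oo)%E.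
Proof.
apply/eqyP => M M0; exact: integral_inv_sin_ge.
Qed.

End InverseSine.

(** * Failure of square integrability on the torus *)

Section Torus.
Local Open Scope quotient_scope.
Variables (R : realType) (f : SO3 R -> R[i]).
Hypothesis hf : forall alpha beta gamma : R, 0 <= beta <= pi ->
  f (euler alpha beta gamma) =
    if (beta != 0) && (beta != pi) then ((Num.sqrt (sin beta))^-1)%:C else 0.
Local Notation mu := (@lebesgue_measure R).
Local Notation cm := (@circle_measure R).
Let piT (x : R) : circle R := \pi_(circle R) x.

Lemma ge0_integral_circle (H : circle R -> \bar R) :
  measurable_fun setT H -> (forall y, 0 <= H y)%E ->
  (\int[cm]_y H y = \int[mu]_(x in @period R) H (piT x))%E.
Proof.
move=> mH H0.
rewrite (@ge0_integral_weighted_pushforward _ _ (measurableTypeR R) (circle R) R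
  mu cm (@period R) piT (cst 1)) //.
- by apply: eq_integral => x _; rewrite mule1.
- exact: measurable_itv.
- exact: measurable_circle_pi.
- move=> A mA; have mD : measurable (@period R `&` piT @^-1` A : set (measurableTypeR R)).
    apply: measurableI; first exact: measurable_itv.
    by rewrite -[X in measurable X]setTI; exact: measurable_circle_pi.
  transitivity (1 * mu (@period R `&` piT @^-1` A))%E; first by rewrite mul1e setIC.
  by rewrite -(integral_cst mu mD).
Qed.

Lemma circle_measureT : cm setT = (pi *+ 2)%:E.
Proof.
rewrite /circle_measure /pushforward /mrestr preimage_setT setTI.
have p0 : 0 < pi *+ 2 :> R by rewrite mulrn_wgt0// pi_gt0.
by rewrite lebesgue_measure_itv/= lte_fin p0 sube0.
Qed.

Lemma not_L2_euler_map : ~ L2 (@torus3_measure R) (f \o @euler_map R).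
Proof.
move=> [[mRe mIm]].
pose G (t : circle R * circle R * circle R) : \bar R :=
  (Normc.normc ((f \o @euler_map R) t) ^+ 2)%:E.
(* The integrand depends on the middle angle only, through the entry cos beta; freezing the outer
   angles gives a measurable section. *)
pose H (y : circle R) := G (piT 0, y, piT 0).
have GH t : G t = H t.1.2.
  rewrite /G /H /G /= !(f_sin_beta hf) /euler_map /sin_beta.
  by do 2 rewrite (let: And5 _ _ e _ _ := euler_entries _ _ _ in e).
have G0 t : (0 <= G t)%E by rewrite lee_fin sqr_ge0.
have mG : measurable_fun setT G.
  have -> : G = fun t => (complex.Re ((f \o @euler_map R) t) ^+ 2 +
      complex.Im ((f \o @euler_map R) t) ^+ 2)%:E.
    apply/funext => t; rewrite /G; case: ((f \o _) t) => a b /=.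
    by rewrite sqr_sqrtr// addr_ge0 ?sqr_ge0.
  by apply/measurable_EFinP; apply: measurable_funD; exact: measurable_funX.
have mH : measurable_fun setT H.
  exact: (measurable_fun_pair2 (piT 0) (measurable_fun_pair1 (piT 0) mG)).
have intH : (\int[cm]_y H y = +oo)%E.
  rewrite ge0_integral_circle//; last by move=> y; exact: G0.
  apply/eqP; rewrite eq_le leey/= -(integral_inv_sin R).
  (* The integrand is nonnegative, so divergence over half of the beta circle is enough. *)
  have sub : (`]0, pi[ : set R) `<=` @period R.
    by move=> x; rewrite /period /= !in_itv/=; have := pi_gt0 R; rewrite mulr2n; lra.
  have mHpi : measurable_fun setT (fun x : R => H (piT x)).
    by apply: (measurableT_comp mH); exact: measurable_circle_pi.
  have -> : (\int[mu]_(x in `]0%R, pi[) ((sin x)^-1)%:E =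
      \int[mu]_(x in `]0%R, pi[) H (piT x))%E.
    apply: eq_integral => x; rewrite inE/= in_itv/= => x0pi.
    rewrite /H /G /= euler_map_pi (f_sin_beta hf).
    have xpi : 0 <= x <= pi by lra.
    by rewrite normc_real2 sin_beta_euler// exprVn sqr_sqrtr// sin_ge0_pi.
  apply: ge0_subset_integral => //; first exact: measurable_itv.
  - exact: measurable_funTS.
  - by move=> x _; exact: G0.
have intG : (\int[@torus3_measure R]_t G t = +oo)%E.
  (* The outer circles have positive mass, so multiplying +oo by it in Tonelli's formula keeps
     +oo. *)
  have p0 : (0 < (pi *+ 2)%:E :> \bar R)%E by rewrite lte_fin mulrn_wgt0// pi_gt0.
  rewrite (@fubini_tonelli1 _ _ _ _ R (sigma_finite_prod_measure cm cm) cm G)//.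
  transitivity (\int[sigma_finite_prod_measure cm cm]_z (H z.2 * (pi *+ 2)%:E))%E.
    apply: eq_integral => z _; rewrite /fubini_F.
    under eq_integral do rewrite GH /=.
    rewrite (@integral_cst _ _ _ cm _ measurableT (H z.2)).
    by congr (_ * _)%E; exact: circle_measureT.
  have mH2 : measurable_fun setT (fun z : circle R * circle R => H z.2 * (pi *+ 2)%:E)%E.
    by apply: emeasurable_funM => //; apply: (measurableT_comp mH); exact: measurable_snd.
  rewrite (@fubini_tonelli1 _ _ _ _ R cm cm _ mH2)/=; last first.
    by move=> z; apply: mule_ge0; [exact: G0|exact: ltW].
  transitivity (\int[cm]_x cst +oo x)%E.
    apply: eq_integral => x _; rewrite /fubini_F/=.
    rewrite ge0_integralZr//=; [|by move=> y _; exact: G0|exact: ltW].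
    by rewrite intH gt0_mulye.
  rewrite (@integral_cst _ _ _ cm _ measurableT +oo%E).
  transitivity (+oo * ((pi : R) *+ 2)%:E)%E; last by rewrite gt0_mulye.
  by congr (_ * _)%E; exact: circle_measureT.
by rewrite -[X in (X < _)%E]/(\int[@torus3_measure R]_t G t)%E intG.
Qed.

End Torus.

Theorem lemma3p7 (R : realType) (f : SO3 R -> R[i])
    (hf : forall alpha beta gamma : R, 0 <= beta <= pi ->
      f (euler alpha beta gamma) =
        if (beta != 0) && (beta != pi) then ((Num.sqrt (sin beta))^-1)%:C else 0) :
  (forall s : R, 0 <= s < 2^-1 -> sobolev s f) /\
  ~ L2 (@torus3_measure R) (f \o @euler_map R).
Proof. by split; [exact: sobolev_f hf|exact: not_L2_euler_map hf]. Qed.
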